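(* There is an absolute constant $c>0$ such that the following holds. Let $G=(V,E,w)$ be a connected graph with positive edge weights $w$, and let $T=\{t_1,\dots,t_k\}\subseteq V$ be a set of $k\ge 2$ terminals. Then there exists a graph $G'=(T,E',w')$ with vertex set exactly $T$ and positive edge weights $w'$, such that the unweighted graph $(T,E')$ is a minor of $G$, and $$\forall t_i,t_j\in T:\quad \mathrm{dist}_G(t_i,t_j)\;\le\;\mathrm{dist}_{G'}(t_i,t_j)\;\le\;\kappa\cdot \mathrm{dist}_G(t_i,t_j)$$ with $\kappa\le c\log^2 k$. Moreover, there is $k_0$ such that whenever $k\ge k_0$ one can take $\kappa\le (2\times 10^8)\cdot\log^2 k$.
   Context: $\mathrm{dist}_H$ denotes the shortest-path distance in a weighted graph $H$. A graph $H'$ is a minor of $H$ if it can be obtained from $H$ by a sequence of edge contractions, edge deletions and vertex deletions. $\log$ denotes the natural logarithm. *)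

(* Defs.v *)
From HB Require Import structures.
From mathcomp Require Import all_boot all_order all_algebra.
From mathcomp Require Import boolp classical_sets reals constructive_ereal ereal exp.

Set Implicit Arguments.
Unset Strict Implicit.
Unset Printing Implicit Defensive.

Import Order.TTheory GRing.Theory Num.Theory.

Local Open Scope ring_scope.

(* A finite simple graph (V, E) whose vertex set V is a subset of a finite    *)
(* type U of vertex names. The ambient U lets graphs with different vertex    *)
(* sets (e.g. a graph and its minors) share their vertices.                   *)
Record graph (U : finType) := Graph {
  verts : {set U};
  edges : {set {set U}};
  edgesP : [forall e in edges, (e \subset verts) && (#|e| == 2)]
}.

Definition adj (U : finType) (H : graph U) : rel U :=
  fun x y => [set x; y]%SET \in edges H.

Definition graph_connected (U : finType) (H : graph U) : Prop :=
  {in verts H &, forall x y, connect (adj H) x y}.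

Definition merge (U : finType) (u v : U) : U -> U :=
  fun x => if x == v then u else x.

(* Contracting {u, v} merges v into u, and the new vertex keeps the name u    *)
(* (u and v may be swapped, so either name can be kept); the resulting loop   *)
(* disappears and parallel edges are identified.                              *)
Variant minor_step (U : finType) (H H' : graph U) : Prop :=
| VertexDeletion v of v \in verts H
    & verts H' = (verts H :\ v)%SET
    & edges H' = [set e in edges H | v \notin e]%SET
| EdgeDeletion e of e \in edges H
    & verts H' = verts H
    & edges H' = (edges H :\ e)%SET
| EdgeContraction u v of adj H u v
    & verts H' = (verts H :\ v)%SET
    & edges H' = [set (merge u v @: (e : {set U}))%SET | e in edges H :\ [set u; v]]%SET.

Inductive minor (U : finType) (H : graph U) : graph U -> Prop :=
| minor_refl : minor H H
| minor_next K H' of minor H K & minor_step K H' : minor H H'.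

Record wgraph (R : realType) (U : finType) := WGraph {
  graph_of :> graph U;
  weight : {set U} -> R;
  weight_gt0 : forall e, e \in edges graph_of -> 0 < weight e
}.

Definition walk_weight (R : realType) (U : finType) (H : wgraph R U)
    (x : U) (p : seq U) : R :=
  \sum_(e <- pairmap (fun a b => [set a; b]%SET) x p) weight H e.

(* Extended-real valued: the distance is +oo when no walk joins x to y.       *)
Definition dist (R : realType) (U : finType) (H : wgraph R U) (x y : U) :
    \bar R :=
  ereal_inf [set (walk_weight H x p)%:E |
    p in [set p | path (adj H) x p /\ last x p = y]]%classic.

Definition approx_minor (R : realType) (U : finType) (G : wgraph R U)
    (T : {set U}) (kappa : R) (G' : wgraph R U) : Prop :=
  [/\ verts G' = T,
      minor G G' &
      {in T &, forall s t,
        (dist G s t <= dist G' s t)%E /\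
        (dist G' s t <= kappa%:E * dist G s t)%E}].

(* Main.v *)
Require Import Defs.
From HB Require Import structures.
From mathcomp Require Import all_boot all_order all_algebra.
From mathcomp Require Import boolp classical_sets reals constructive_ereal ereal exp.
From mathcomp Require Import sequences ring lra zify.

(* Terminals are processed one after the other. Terminal t claims, for some   *)
(* radius rho = 1 + g / m with g <= m and m close to 4 ln k, the component of *)
(* t in the graph of the unclaimed vertices v with d(v, t) <= rho d(v, T).    *)
(* All vertices end up claimed, and contracting the clusters gives G', where  *)
(* an edge st gets the weight d(s, t).                                        *)
(*   To bound a distance in G', follow a shortest path of G between two       *)
(* terminals. Its vertices start active; a cluster that hits active vertices  *)
(* deactivates all those from the first to the last hit and labels them by    *)
(* its terminal. The labels at the end spell a walk in G', of length at most  *)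
(* that of the path plus a sum of terms 2 d(v, T) at the label changes. These *)
(* terms are charged to a potential: an active edge carries M = 100 m times   *)
(* its length, an active vertex v at the border of an active stretch 14       *)
(* d(v, T). Raising g by one makes the cluster swallow a further stretch of   *)
(* length d(v, T) / (3 m) beyond the last hit v, or the rest of the active    *)
(* stretch, which saves more potential than stopping at v costs. So, for g    *)
(* with a truncated geometric law, the expectation of the exponential of the  *)
(* rescaled potential grows by a factor of at most 1 + (3/4)^m. Summing over  *)
(* all pairs of terminals and picking at each step a g that does not exceed   *)
(* the average gives one G' with distortion O(log k).                         *)

(** The scheme above rests on a few results. [base_potential_gain] is the deterministic core:
    growing a cluster past a hit saves at least three quarters of what stopping there would cost.
    [geometric_law_mean_expR] turns this trade into a bound on an exponential moment, and
    [geometric_law_mean_potential] applies it to both ends of the swallowed stretch at once.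
    [exists_clustering] multiplies the bound over the terminals and removes the randomness by
    averaging. For k terminals, m >= 4 ln k keeps the product of the k factors below e; with at most
    k^2 pairs and initial rescaled potential 100 m / 96, every final one is O(ln k).
    [contraction_dist_ge] and [contraction_dist_le] translate this into distances, and
    [quotient_minor] shows that the contraction is a minor. The log^2 bound follows because ln k >=
    1/2. *)

Set Implicit Arguments.
Unset Strict Implicit.
Unset Printing Implicit Defensive.

Import Order.TTheory GRing.Theory Num.Theory.

Local Open Scope ring_scope.

(** * The potential of a labelled path *)

(* The weights are [(3/4)^g / 4] at [g < m] and [(3/4)^m] at [m]. *)
Fixpoint geometric_law_mean (R : realType) (m : nat) (u : nat -> R) : R :=
  if m is m'.+1 then u 0%N / 4 + 3 / 4 * geometric_law_mean m' (fun g => u g.+1)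
  else u 0%N.

Lemma geometric_law_mean_sum (R : realType) (I : Type) (r : seq I) (P : pred I)
    (m : nat) (u : I -> nat -> R) :
  geometric_law_mean m (fun g => \sum_(i <- r | P i) u i g) =
  \sum_(i <- r | P i) geometric_law_mean m (u i).
Proof.
elim: m u => [|m IH] u //=.
by rewrite IH mulr_suml mulr_sumr -big_split.
Qed.

(** Some value does not exceed the average; this replaces the random radius by a fixed one. *)
Lemma geometric_law_mean_ge (R : realType) (m : nat) (u : nat -> R) :
  exists2 g, (g <= m)%N & u g <= geometric_law_mean m u.
Proof.
elim: m u => [|m IH] u /=; first by exists 0%N.
have [g gm ug] := IH (fun g => u g.+1).
have [u0|u0] := leP (u 0%N) (geometric_law_mean m (fun g => u g.+1)).
  by exists 0%N => //; lra.
by exists g.+1 => //; lra.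
Qed.

Lemma expR_le_inv (R : realType) (y : R) : y < 1 -> expR y <= (1 - y)^-1.
Proof.
move=> y1; rewrite -[y]opprK expRN lef_pV2 ?posrE ?expR_gt0 ?subr_gt0 ?opprK //.
exact: expR_ge1Dx.
Qed.

(** One round of growth: stopping, with probability 1/4, costs [y]; going on saves [3/4 y]. To first
    order the balance is y/4 - 9y/16 < 0, and [y <= 1/3] leaves room for the second order. *)
Lemma expR_stop_or_gain (R : realType) (y : R) : 0 <= y -> y <= 1 / 3 ->
  expR y / 4 + 3 / 4 * expR (- (3 / 4 * y)) <= 1.
Proof.
move=> y0 y1.
have e1 : expR y <= (1 - y)^-1 by apply: expR_le_inv; lra.
have e2 : expR (- (3 / 4 * y)) <= (1 + 3 / 4 * y)^-1.
  apply: le_trans (expR_le_inv _) _; first lra.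
  by rewrite opprK.
have p1 : 0 < 1 - y by lra.
have p2 : 0 < 1 + 3 / 4 * y by lra.
have h : (1 - y)^-1 / 4 + 3 / 4 * (1 + 3 / 4 * y)^-1 <= 1.
  have -> : (1 - y)^-1 / 4 + 3 / 4 * (1 + 3 / 4 * y)^-1 =
    (1 - 9 / 16 * y) / ((1 - y) * (1 + 3 / 4 * y)).
    by field; rewrite !lt0r_neq0 //; lra.
  by rewrite ler_pdivrMr ?mulr_gt0 // mul1r; nra.
apply: le_trans h; lra.
Qed.

(** Here [stop g] is the outcome if growth ends at [g], and [base g] its value before the stopping
    cost [Y g]. Every round is balanced by [expR_stop_or_gain] except the forced stop at [m], which
    has probability (3/4)^m and costs a factor of at most 3/2. *)
Lemma geometric_law_mean_expR (R : realType) (lam : R) (m : nat)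
    (stop base Y : nat -> R) :
  0 <= lam ->
  (forall g, 0 <= lam * Y g <= 1 / 3) ->
  (forall g, (g <= m)%N -> stop g <= base g + Y g) ->
  (forall g, (g < m)%N -> base g.+1 <= base g - 3 / 4 * Y g) ->
  geometric_law_mean m (fun g => expR (lam * stop g)) <=
  (1 + (3 / 4) ^+ m) * expR (lam * base 0%N).
Proof.
move=> lam0; elim: m stop base Y => [|m IH] stop base Y hY hs hb /=.
  have /andP[y0 y1] := hY 0%N.
  have h : expR (lam * stop 0%N) <= expR (lam * base 0%N) * expR (lam * Y 0%N).
    by rewrite -expRD ler_expR -mulrDr ler_wpM2l // hs.
  apply: le_trans h _; rewrite mulrC ler_wpM2r ?expR_ge0 // expr0.
  apply: le_trans (expR_le_inv _) _; first lra.
  by rewrite -div1r ler_pdivrMr; lra.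
have /andP[y0 y1] := hY 0%N.
have := IH (fun g => stop g.+1) (fun g => base g.+1) (fun g => Y g.+1)
  (fun g => hY g.+1) (fun g => hs g.+1) (fun g => hb g.+1).
set F := geometric_law_mean _ _ => hF.
have h1 : expR (lam * stop 0%N) <= expR (lam * base 0%N) * expR (lam * Y 0%N).
  by rewrite -expRD ler_expR -mulrDr ler_wpM2l // hs.
have h2 : expR (lam * base 1%N) <=
    expR (lam * base 0%N) * expR (- (3 / 4 * (lam * Y 0%N))).
  rewrite -expRD ler_expR; have := ler_wpM2l lam0 (hb 0%N isT).
  by rewrite mulrBr mulrCA.
have h3 := expR_stop_or_gain y0 y1.
have e1 : expR (- (3 / 4 * (lam * Y 0%N))) <= 1 by rewrite expR_le1; lra.
have q0 : 0 <= (3 / 4 : R) ^+ m by rewrite exprn_ge0 //; lra.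
rewrite exprS; set q := _ ^+ m in q0 hF *.
set E := expR (lam * base 0%N) in h1 h2 *.
have E0 : 0 <= E by exact: expR_ge0.
set a := expR (lam * Y 0%N) in h1 h3; set b := expR (- _) in h2 h3 e1.
have hF' : F <= (1 + q) * (E * b).
  by apply: le_trans hF _; rewrite ler_wpM2l //; lra.
have : E * (a / 4 + 3 / 4 * b) <= E * 1 by rewrite ler_wpM2l.
have : q * (E * b) <= q * (E * 1) by rewrite !ler_wpM2l.
lra.
Qed.

(** * Cost and gain at one end of the swallowed stretch *)

Section Potential.
Variables (R : realType) (U : eqType).
Implicit Types (x D : nat -> R) (lab : nat -> option U).

(** The 2 is the bound on d(v, s) / d(v, T) for a vertex [v] owned by [s]. The excess 12 at an
    active border is the saving demanded in [base_potential_gain]. *)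
Definition end_coef (o : option U) : R := if o is None then 14 else 2.

Definition edge_potential (M : R) x D lab (i : nat) : R :=
  if lab i == lab i.+1 then
    if lab i is None then M * (x i.+1 - x i) else 0
  else end_coef (lab i) * D i + end_coef (lab i.+1) * D i.+1.

Definition potential M x D lab (a : nat) : R :=
  \sum_(i < a) edge_potential M x D lab i.

(** The potential left of [a] once [a] becomes the first vertex of a newly labelled stretch. At the
    end of the path nothing lies to the left, whence 0. *)
Definition cut_potential M x D lab (a : nat) : R :=
  if a is a'.+1 then
    potential M x D lab a' + end_coef (lab a') * D a' + 2 * D a
  else 0.

(** All that is kept of a shortest path starting at a terminal: positions [x] and distances [D] to
    the terminals. The last clause also makes [x] nondecreasing. *)
Definition profile x D : Prop :=
  [/\ D 0%N = 0, forall i, 0 <= D i &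
      forall i j, (i <= j)%N -> `|D i - D j| <= x j - x i].

Variables (M : R) (x D : nat -> R) (lab : nat -> option U).
Local Notation psi := (edge_potential M x D lab).
Local Notation W := (potential M x D lab).
Local Notation s := (cut_potential M x D lab).

Lemma potentialS a : W a.+1 = W a + psi a.
Proof. by rewrite /potential big_ord_recr. Qed.

Lemma potential_active a b : (a <= b)%N ->
  (forall i, (a <= i <= b)%N -> lab i = None) -> W b = W a + M * (x b - x a).
Proof.
move=> /subnK <-; elim: (b - a)%N => [|k IH] h; first by rewrite subrr mulr0 addr0.
rewrite addSn potentialS IH; last by move=> i hi; apply: h; lia.
rewrite /edge_potential !h ?eqxx /=; try lia.
by ring.
Qed.

Lemma last_inactive a b : (a <= b)%N -> lab b = None ->
  (forall i, (a <= i <= b)%N -> lab i = None) \/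
  exists i t, [/\ (a <= i < b)%N, lab i = Some t &
                  forall j, (i < j <= b)%N -> lab j = None].
Proof.
move=> ab lb; move: ab => /subnK e; move: lb; rewrite -e.
move: (b - a)%N => k {e} lb.
suff H : forall l, (l <= k)%N -> (forall i, (l + a <= i <= k + a)%N -> lab i = None) \/
  exists i t, [/\ (l + a <= i < k + a)%N, lab i = Some t &
                  forall j, (i < j <= k + a)%N -> lab j = None].
  by exact: (H 0%N).
move=> l /subnK; move: (k - l)%N => z; elim: z l => [|z IH] l e.
  by left => i hi; rewrite (_ : i = k + a)%N //; lia.
have [h|[i [t [h1 h2 h3]]]] := IH l.+1 ltac:(lia); last first.
  by right; exists i, t; split => //; lia.
case E : (lab (l + a)%N) => [t|].
  by right; exists (l + a)%N, t; split; [lia | by [] | move=> j hj; apply: h; lia].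
left => i hi; have [<-//|ne] := eqVneq (l + a)%N i.
by apply: h; lia.
Qed.

Hypotheses (xD : profile x D) (M14 : 14 <= M).

Let D0 : D 0%N = 0. Proof. by case: xD. Qed.
Let Dge0 i : 0 <= D i. Proof. by case: xD. Qed.
Let Dle i j : (i <= j)%N -> D i <= D j + (x j - x i).
Proof. by case: xD => _ _ h /h; rewrite ler_norml => /andP[? ?]; lra. Qed.
Let Dge i j : (i <= j)%N -> D j <= D i + (x j - x i).
Proof. by case: xD => _ _ h /h; rewrite ler_norml => /andP[? ?]; lra. Qed.
Let xle i j : (i <= j)%N -> x i <= x j.
Proof. by case: xD => _ _ h /h /(le_trans (normr_ge0 _)); rewrite subr_ge0. Qed.

Lemma edge_potential_ge0 i : 0 <= psi i.
Proof.
rewrite /edge_potential; have h := xle (leqnSn i); have M0 := M14.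
have := Dge0 i; have := Dge0 i.+1.
case: eqP => _; case: (lab i) => [?|]; case: (lab i.+1) => [?|] //=; try lra.
- by move=> _ _; rewrite mulr_ge0 //; lra.
- by move=> _ _; rewrite mulr_ge0 //; lra.
Qed.

Lemma le_potential a b : (a <= b)%N -> W a <= W b.
Proof.
move=> /subnK <-; elim: (b - a)%N => [|k IH] //; rewrite addSn potentialS.
by have := edge_potential_ge0 (k + a); lra.
Qed.

Lemma potential_ge0 a : 0 <= W a.
Proof. by have := le_potential (leq0n a); rewrite {1}/potential big_ord0. Qed.

(* What remains to the left of a hit at [a] if the cluster keeps growing: the *)
(* cost [s a - base_potential a] of stopping at [a] is then not incurred.     *)
Definition base_potential a : R := Num.min (W a) (s a).

Lemma base_potential_le a : base_potential a <= W a.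
Proof. by rewrite /base_potential ge_min lexx. Qed.

Lemma cut_le_base a : lab a = None ->
  base_potential a <= s a <= base_potential a + 16 * D a.
Proof.
move=> la; rewrite /base_potential.
have h : s a <= W a + 16 * D a.
  case: a la => [|a] la; first by rewrite D0 mulr0 addr0 potential_ge0.
  rewrite /cut_potential potentialS /edge_potential la.
  have := Dge0 a.+1; have := Dge0 a; have := Dle (leqnSn a).
  case: (lab a) => [t|] /=; first lra.
  have : 14 * (x a.+1 - x a) <= M * (x a.+1 - x a).
    by rewrite ler_wpM2r // subr_ge0 xle.
  lra.
have := Dge0 a.
by case: (leP (W a) (s a)) => ? ?; lra.
Qed.

(** The first hit moves from [a] to [a'] when the cluster grows. If the next vertex to the left is
    active as well, the last hypothesis says that it was out of reach, so a long active stretch has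
    been swallowed; otherwise a border or the end of the path has been reached. *)
Lemma base_potential_gain (r : R) a a' : 0 < r -> 28 * r + 16 <= M ->
  (a' <= a)%N -> lab a = None -> lab a' = None ->
  (forall i, a' = i.+1 -> (forall h, (i <= h <= a)%N -> lab h = None) ->
    D a < r * (x a - x i)) ->
  base_potential a' <= base_potential a - 3 / 4 * (s a - base_potential a).
Proof.
move=> r0 Mr le_a la la' hfar.
have /andP[_ hsa] := cut_le_base la.
have bW : base_potential a' <= W a' by exact: base_potential_le.
have bs : base_potential a' <= s a' by rewrite /base_potential ge_min lexx orbT.
have [sW|Ws] := leP (s a) (W a).
  have -> : base_potential a = s a by rewrite /base_potential; apply/min_idPr.
  rewrite subrr mulr0 subr0.
  have [-> //|ne] := eqVneq a' a; first by rewrite /base_potential ge_min lexx orbT.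
  apply: le_trans bW _.
  case: a le_a ne la {la' hsa sW hfar bs} => [|a] le_a ne la; first by lia.
  rewrite /cut_potential; have := @le_potential a' a ltac:(lia).
  have := Dge0 a.+1; have := Dge0 a.
  by case: (lab a) => [?|] /=; lra.
have eb : base_potential a = W a by rewrite /base_potential; apply/min_idPl/ltW.
(* Stopping at [a] costs at most 16 [D a] by [cut_le_base], and 3/4 of that is 12 [D a]. *)
suff : base_potential a' <= W a - 12 * D a by rewrite eb in hsa *; lra.
have Mx i j : (i <= j)%N -> 14 * (x j - x i) <= M * (x j - x i).
  by move=> ij; rewrite ler_wpM2r // subr_ge0 xle.
have Da := Dge0 a.
have [hact|[i [t [hi li hact]]]] := last_inactive le_a la; last first.
  (* A labelled vertex was swallowed: the border at [i.+1] releases 14 [D i.+1] and the active edges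
     at least 14 per unit of length, together at least 14 [D a]. *)
  have e1 : W a = W i.+1 + M * (x a - x i.+1).
    by apply: potential_active => [|h hh]; [lia|apply: hact; lia].
  have e2 : psi i = 2 * D i + 14 * D i.+1.
    by rewrite /edge_potential li hact //; lia.
  have := @le_potential a' i ltac:(lia); have := @Mx i.+1 a ltac:(lia).
  have := @Dge i.+1 a ltac:(lia); have := Dge0 i.
  by rewrite potentialS e2 in e1; lra.
have e1 := potential_active le_a hact.
have M1 := Mx _ _ le_a; have D1 := Dge le_a; have D2 := Dge0 a'.
case: a' le_a la' hfar hact bW bs e1 M1 D1 D2 => [|c] le_a la' hfar hact bW bs e1 M1 D1 D2.
  (* The end of the path was reached; as [D] vanishes there, the active edges alone release 14
     [D a]. *)
  have W0 : W 0%N = 0 by rewrite /potential big_ord0.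
  by move: D1 bW e1; rewrite D0 W0; lra.
case E : (lab c) => [t|].
  (* The hit is at the border, whose coefficient drops from 14 to 2. *)
  have e3 : psi c = 2 * D c + 14 * D c.+1 by rewrite /edge_potential E la'.
  by move: bs e1 (xle le_a); rewrite potentialS e3 /cut_potential E /=; lra.
have hact' h : (c <= h <= a)%N -> lab h = None.
  by move=> hh; have [<-//|ne] := eqVneq c h; apply: hact; lia.
(* The new border costs 14 [D c] + 2 [D c.+1]. With the required 12 [D a] this is at most 28 [D a] +
   16 (x a - x c), which the active edges from [c] to [a] pay for. *)
have lt := hfar c erefl hact'.
have e3 := potential_active (ltnW le_a) hact'.
have D3 := Dle (ltnW le_a); have D4 := Dle le_a.
have Mlt : (28 * r + 16) * (x a - x c) <= M * (x a - x c).
  by rewrite ler_wpM2r // subr_ge0 xle // ltnW.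
have h28 : 28 * D a <= 28 * (r * (x a - x c)) by rewrite ler_pM2l // ltW.
have xc : x c <= x c.+1 by apply: xle.
have x1 := xle (ltnW le_a).
move: bs; rewrite /cut_potential E /=; lra.
Qed.

End Potential.

(** * Both ends at once: reversal and relabelling of a hull *)

Definition first (n : nat) (P : pred nat) : nat := find P (iota 0 n.+1).

Lemma firstP n (P : pred nat) i : P i -> (i <= n)%N ->
  P (first n P) /\ (first n P <= i)%N.
Proof.
move=> Pi le_in; have le_fi : (first n P <= i)%N.
  rewrite leqNgt; apply/negP => /(before_find 0%N).
  by rewrite nth_iota ?add0n ?Pi.
split=> //; have hP : has P (iota 0 n.+1).
  by apply/hasP; exists i => //; rewrite mem_iota add0n ltnS.
by have := nth_find 0%N hP; rewrite nth_iota ?add0n // ltnS (leq_trans le_fi).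
Qed.

Section Reversal.
Variables (R : realType) (U : eqType).
Implicit Types (x D : nat -> R) (lab : nat -> option U).

Definition rev_pos n x i := x n - x (n - i)%N.
Definition rev_fun T n (f : nat -> T) i := f (n - i)%N.

Lemma profile_rev n x D : D n = 0 -> profile x D ->
  profile (rev_pos n x) (rev_fun n D).
Proof.
move=> Dn [D0 Dge0 Dl]; split=> [|i|i j ij]; rewrite /rev_fun ?subn0 //.
have := @Dl (n - j)%N (n - i)%N ltac:(lia); rewrite distrC /rev_pos.
by move/le_trans; apply; lra.
Qed.

(** The potential splits at a vertex, so the right end of a stretch is handled as a left end of the
    reversed path. *)
Lemma potential_rev M n x D lab c : (c <= n)%N ->
  potential M (rev_pos n x) (rev_fun n D) (rev_fun n lab) c +
  potential M x D lab (n - c) = potential M x D lab n.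
Proof.
elim: c => [|c IH] cn; first by rewrite {1}/potential big_ord0 add0r subn0.
rewrite -IH ?(ltnW cn) // potentialS -addrA; congr (_ + _).
have e : (n - c = (n - c.+1).+1)%N by lia.
rewrite e potentialS addrC; congr (_ + _).
rewrite /edge_potential /rev_fun /rev_pos e eq_sym; case: eqP => [->|_].
  by case: (lab _) => // ; congr (_ * _); ring.
by rewrite addrC.
Qed.

Lemma potential_relabeled M x D lab lab' a t :
  (forall i, (i < a)%N -> lab' i = lab i) -> lab' a = Some t ->
  (forall i, 0 <= D i) ->
  potential M x D lab' a <= cut_potential M x D lab a.
Proof.
move=> eql la D0; case: a eql la => [|a] eql la.
  by rewrite /potential big_ord0.
rewrite potentialS /cut_potential -addrA lerD //.
  rewrite /potential le_eqVlt; apply/orP; left; apply/eqP.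
  by apply: eq_bigr => i _; rewrite /edge_potential !eql //; have := ltn_ord i; lia.
rewrite /edge_potential la eql //; have := D0 a; have := D0 a.+1.
by case: (lab a) => [?|] //=; case: eqP => _; lra.
Qed.

Definition relabel a b (t : U) lab i := if (a <= i <= b)%N then Some t else lab i.

(** Edges inside the relabelled stretch are free, so only the two cuts remain. Equality can fail if
    a neighbour of the stretch already carries [t]. *)
Lemma potential_relabel M n x D lab a b t : (a <= b)%N -> (b <= n)%N ->
  (forall i, 0 <= D i) ->
  potential M x D (relabel a b t lab) n <=
  cut_potential M x D lab a +
  cut_potential M (rev_pos n x) (rev_fun n D) (rev_fun n lab) (n - b).
Proof.
move=> ab bn D0; set lab' := relabel a b t lab.
have eb : potential M x D lab' b = potential M x D lab' a.
  have H k : (a + k <= b)%N -> potential M x D lab' (a + k) = potential M x D lab' a.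
    elim: k => [|k IH] hk; first by rewrite addn0.
    rewrite addnS potentialS IH; last by lia.
    have e j : (a <= j <= b)%N -> lab' j = Some t by rewrite /lab' /relabel => ->.
    by rewrite /edge_potential !e ?eqxx ?addr0 //; lia.
  by have := H (b - a)%N; rewrite subnKC // => ->.
rewrite -(@potential_rev M n x D lab' (n - b)) ?leq_subr // subKn // eb addrC.
apply: lerD; apply: (@potential_relabeled _ _ _ _ _ _ t) => //.
- by move=> i ia; rewrite /lab' /relabel ifF //; lia.
- by rewrite /lab' /relabel leqnn ab.
- by move=> i ib; rewrite /rev_fun /lab' /relabel ifF //; lia.
- by rewrite /rev_fun /lab' /relabel subKn // leqnn ab.
- by move=> i; exact: D0.
Qed.

Lemma first_gain M r x D lab n (P P' : pred nat) i0 :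
  profile x D -> 0 < r -> 28 * r + 16 <= M ->
  P i0 -> subpred P P' ->
  (forall i, P' i -> (i <= n)%N /\ lab i = None) ->
  (forall i h, P i -> (h <= i)%N ->
     (forall l, (h <= l <= i)%N -> lab l = None) ->
     r * (x i - x h) <= D i -> P' h) ->
  let s := cut_potential M x D lab in
  let base := base_potential M x D lab in
  base (first n P') <=
  base (first n P) - 3 / 4 * (s (first n P) - base (first n P)).
Proof.
move=> xD r0 Mr Pi PP' hP' hgrow /=.
have [in0 _] := hP' _ (PP' _ Pi).
have [Pa _] := firstP Pi in0.
have [an la] := hP' _ (PP' _ Pa).
have [Pa' le_a] := firstP (PP' _ Pa) an.
have [_ la'] := hP' _ Pa'.
apply: (base_potential_gain xD _ r0) => //; first lra.
move=> i ei hact; rewrite ltNge; apply/negP => hD.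
have ia : (i <= first n P)%N by rewrite ltnW // -ei.
have [_] := firstP (hgrow _ _ Pa ia hact hD) (leq_trans ia an).
by rewrite ei ltnn.
Qed.

(** [first] returns [n.+1] when the search fails, so for [C] inside [0, n] the test detects whether
    there is any hit. The right end is the first hit of the reversed path. *)
Definition relabel_hull n (C : pred nat) (t : U) lab : nat -> option U :=
  if C (first n C) then
    relabel (first n C) (n - first n (fun i => (i <= n)%N && C (n - i)%N)) t lab
  else lab.

Lemma relabel_hullP n (C : pred nat) t lab : (forall i, C i -> (i <= n)%N) ->
  ((forall i, ~~ C i) /\ relabel_hull n C t lab = lab) \/
  exists a b, [/\ C a, C b, (forall i, C i -> (a <= i <= b)%N) &
                  relabel_hull n C t lab = relabel a b t lab].
Proof.
move=> hn; rewrite /relabel_hull; case: ifPn => [ca|nca]; last first.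
  left; split=> // i; apply: contra nca => ci.
  by have [] := firstP ci (hn _ ci).
right; set a := first n _ in ca *; set b' := first n _.
pose Q i := (i <= n)%N && C (n - i)%N.
have Q_ i : C i -> Q (n - i)%N /\ (n - i <= n)%N.
  by move=> ci; rewrite /Q leq_subr subKn ?hn.
have [Qa na] := Q_ _ ca.
have [/andP[b'n cb] _] := firstP Qa na.
exists a, (n - b')%N; split=> // i ci.
have [_ le1] := firstP ci (hn _ ci).
have [Qi ni] := Q_ _ ci.
have [_ le2] := firstP Qi ni.
have le1' : (a <= i)%N by [].
have le2' : (b' <= n - i)%N by [].
by have := hn _ ci; move: le1' le2'; clear; lia.
Qed.

(** [cov g] is the set of active hits at radius index [g]. The two growth hypotheses say that one
    more step reaches along the active stretch to distance [D i / (3 m)] from a hit. As long as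
    nothing is hit, the path neither pays nor gains. *)
Lemma geometric_law_mean_potential M m n x D lab t (cov : nat -> pred nat) (lam : R) :
  profile x D -> D n = 0 -> (0 < m)%N -> 100 * m%:R <= M ->
  (forall g i, cov g i -> cov g.+1 i) ->
  (forall g i, cov g i -> (i <= n)%N /\ lab i = None) ->
  (forall g i h, (g < m)%N -> cov g i -> (h <= i)%N ->
     (forall l, (h <= l <= i)%N -> lab l = None) ->
     3 * m%:R * (x i - x h) <= D i -> cov g.+1 h) ->
  (forall g i h, (g < m)%N -> cov g i -> (i <= h)%N -> (h <= n)%N ->
     (forall l, (i <= l <= h)%N -> lab l = None) ->
     3 * m%:R * (x h - x i) <= D i -> cov g.+1 h) ->
  0 <= lam -> lam * (96 * (x n - x 0%N)) <= 1 ->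
  geometric_law_mean m
    (fun g => expR (lam * potential M x D (relabel_hull n (cov g) t lab) n)) <=
  (1 + (3 / 4) ^+ m) * expR (lam * potential M x D lab n).
Proof.
move=> xD Dn m0 Mm cov_mono cov_active cov_left cov_right lam0 lamL.
have m1 : 1 <= m%:R :> R by rewrite ler1n.
have [D0 Dge0 Dl] := xD.
have xD' := profile_rev Dn xD.
have DL i : (i <= n)%N -> D i <= x n - x 0%N.
  move=> i_n; have := Dl _ _ (leq0n i); have := Dl _ _ i_n.
  by rewrite Dn D0 !ler_norml => /andP[? ?] /andP[? ?]; have := Dge0 i; lra.
pose covr g i := (i <= n)%N && cov g (n - i)%N.
pose a g := first n (cov g); pose b g := first n (covr g).
pose s := cut_potential M x D lab.
pose s' := cut_potential M (rev_pos n x) (rev_fun n D) (rev_fun n lab).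
pose B := base_potential M x D lab.
pose B' := base_potential M (rev_pos n x) (rev_fun n D) (rev_fun n lab).
pose tch g := cov g (a g).
pose base g := if tch g then B (a g) + B' (b g) else potential M x D lab n.
pose Y g := if tch g then s (a g) - B (a g) + (s' (b g) - B' (b g)) else 0.
have M14 : 14 <= M by lra.
have touch g : tch g -> [/\ (a g <= n - b g)%N, (b g <= n)%N,
    lab (a g) = None & rev_fun n lab (b g) = None].
  move=> ca; have [an la] := cov_active _ _ ca.
  have Qa : covr g (n - a g)%N by rewrite /covr leq_subr subKn.
  have [/andP[bn cb] bna] := firstP Qa (leq_subr _ _).
  have [_ lb] := cov_active _ _ cb; split=> //.
  by have [_ ] := firstP cb (leq_subr _ _).
have Bs g : tch g -> B (a g) <= s (a g) <= B (a g) + 16 * D (a g) /\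
    B' (b g) <= s' (b g) <= B' (b g) + 16 * D (n - b g)%N.
  move=> /touch[_ _ la lb].
  by split; [exact: cut_le_base xD M14 _ la|exact: cut_le_base xD' M14 _ lb].
have base0 : base 0%N <= potential M x D lab n.
  rewrite /base; case: ifP => // t0; have [ab bn _ _] := touch _ t0.
  have h1 : B (a 0%N) <= potential M x D lab (n - b 0%N).
    apply: le_trans (base_potential_le _ _ _ _ _) _.
    by apply: le_potential.
  have := base_potential_le M (rev_pos n x) (rev_fun n D) (rev_fun n lab) (b 0%N).
  rewrite -(potential_rev M x D lab bn) -/B' => ?; lra.
apply: (@le_trans _ _ ((1 + (3 / 4) ^+ m) * expR (lam * base 0%N))); last first.
  apply: ler_wpM2l; last by rewrite ler_expR ler_wpM2l.
  by rewrite addr_ge0 // exprn_ge0 //; lra.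
apply: (@geometric_law_mean_expR _ lam m _ base Y) => // [g|g gm|g gm].
- rewrite /Y; case: ifP => [tg|_]; last by rewrite mulr0; apply/andP; split; lra.
  have [/andP[h1 h2] /andP[h3 h4]] := Bs g tg.
  have [ab bn _ _] := touch _ tg.
  have h5 := DL _ (leq_trans ab (leq_subr _ _)).
  have h6 := DL _ (leq_subr (b g) n).
  apply/andP; split; first by apply: mulr_ge0 => //; clear - h1 h3; lra.
  (* Each end costs at most 16 [D], and [D] is at most the length of the path; the 96 in the bound
     on [lam] is 3 * 32, giving the required 1/3. *)
  have h7 : s (a g) - B (a g) + (s' (b g) - B' (b g)) <= 32 * (x n - x 0%N).
    by clear - h2 h4 h5 h6; lra.
  by have := ler_wpM2l lam0 h7; clear - lamL; lra.
- rewrite /base /Y /relabel_hull -/(a g) -/(tch g); case: ifP => [tg|_]; last lra.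
  have [ab bn _ _] := touch _ tg.
  have := potential_relabel M x lab t ab (leq_subr _ _) Dge0.
  by rewrite subKn // -/(b g) -/s -/s'; lra.
- have mono i : cov g i -> cov g.+1 i by apply: cov_mono.
  rewrite /base /Y; case: ifP => [tg1|ntg1]; last first.
    have -> : tch g = false.
      apply/negP => tg; move/negP: ntg1; apply.
      by have [] := firstP (mono _ tg) (cov_active _ _ tg).1.
    by rewrite mulr0 subr0.
  have [ab1 bn1 _ _] := touch _ tg1.
  case: ifP => [tg|ntg]; last first.
    rewrite mulr0 subr0.
    have h1 : B (a g.+1) <= potential M x D lab (n - b g.+1).
      apply: le_trans (base_potential_le _ _ _ _ _) _.
      by apply: le_potential.
    have := base_potential_le M (rev_pos n x) (rev_fun n D) (rev_fun n lab) (b g.+1).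
    rewrite -(potential_rev M x D lab bn1) -/B' => ?; lra.
  have [ab bn la lb] := touch _ tg.
  have r0 : 0 < 3 * m%:R :> R by lra.
  (* This is where the factor 100 in [M] comes from: 84 m + 16 <= 100 m. *)
  have Mr : 28 * (3 * m%:R) + 16 <= M by lra.
  have gL : B (a g.+1) <= B (a g) - 3 / 4 * (s (a g) - B (a g)).
    exact: (first_gain (P := cov g) xD r0 Mr tg mono (cov_active g.+1)
      (fun i h => @cov_left g i h gm)).
  have Qb : covr g (b g).
    have Qa : covr g (n - a g)%N by rewrite /covr leq_subr subKn // (leq_trans ab) ?leq_subr.
    by have [] := firstP Qa (leq_subr _ _).
  have monor : subpred (covr g) (covr g.+1).
    by move=> i /andP[i_n ci]; rewrite /covr i_n mono.
  have gR : B' (b g.+1) <= B' (b g) - 3 / 4 * (s' (b g) - B' (b g)).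
    apply: (first_gain (P := covr g) xD' r0 Mr Qb monor _ _).
      by move=> i /andP[i_n /cov_active[_ ?]].
    move=> i h /andP[i_n ci] hi hact hD; rewrite /covr (leq_trans hi) //=.
    apply: (cov_right _ _ _ gm ci); [exact: leq_sub2l|exact: leq_subr| |].
      move=> l hl; have := hact (n - l)%N ltac:(clear - hl hi i_n; lia).
      by rewrite /rev_fun subKn //; case/andP: hl => _ /leq_trans; apply; rewrite leq_subr.
    apply: le_trans hD; rewrite ler_pM2l // /rev_pos le_eqVlt; apply/orP; left.
    by apply/eqP; ring.
  by clear - gL gR; lra.
Qed.

End Reversal.

(** * Shortest paths *)

Section Distance.
Variables (R : realType) (U : finType) (G : wgraph R U).

Lemma adj_sym : symmetric (adj G).
Proof. by move=> u v; rewrite /adj finset.setUC. Qed.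

Lemma adj_verts u v : adj G u v -> [/\ u \in verts G, v \in verts G & u != v].
Proof.
rewrite /adj => uv; have /forallP/(_ [set u; v]%SET) := edgesP G.
rewrite uv /= finset.subUset !finset.sub1set cards2 => /andP[/andP[-> ->]].
by case: (u =P v).
Qed.

Lemma walk_weight_cons x y p :
  walk_weight G x (y :: p) = weight G [set x; y]%SET + walk_weight G y p.
Proof. by rewrite /walk_weight /= big_cons. Qed.

Lemma walk_weight_nil x : walk_weight G x [::] = 0.
Proof. by rewrite /walk_weight /= big_nil. Qed.

Lemma walk_weight_cat x p q :
  walk_weight G x (p ++ q) = walk_weight G x p + walk_weight G (last x p) q.
Proof. by rewrite /walk_weight pairmap_cat big_cat. Qed.

Lemma walk_weight_ge0 x p : path (adj G) x p -> 0 <= walk_weight G x p.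
Proof.
elim: p x => [|y p IH] x; first by rewrite walk_weight_nil.
rewrite walk_weight_cons => /andP[xy yp].
by rewrite addr_ge0 ?IH // ltW // weight_gt0.
Qed.

Lemma walk_rev x p : path (adj G) x p ->
  exists q, [/\ path (adj G) (last x p) q, last (last x p) q = x &
                walk_weight G (last x p) q = walk_weight G x p].
Proof.
elim: p x => [|y p IH] x /=; first by move=> _; exists [::].
move=> /andP[xy /IH[q [q1 q2 q3]]]; exists (rcons q x); split.
- by rewrite rcons_path q1 q2 adj_sym.
- by rewrite last_rcons.
- rewrite -cats1 walk_weight_cat q2 q3 !walk_weight_cons walk_weight_nil addr0.
  by rewrite addrC finset.setUC.
Qed.

Lemma walk_uniq x p : path (adj G) x p ->
  exists q, [/\ path (adj G) x q, last x q = last x p, uniq (x :: q) &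
                walk_weight G x q <= walk_weight G x p].
Proof.
elim: p x => [|y p IH] x; first by exists [::].
move=> /= /andP[xy /IH[q [q1 q2 q3 q4]]].
have [xq|xq] := boolP (x \in y :: q); last first.
  exists (y :: q); split; rewrite /= ?xy ?q1 //; first by rewrite -/(uniq (y :: q)) xq.
  by rewrite !walk_weight_cons lerD2l.
have pf : path (adj G) x (y :: q) by rewrite /= xy.
have uf : uniq (y :: q) by [].
have wf : walk_weight G x (y :: q) <= walk_weight G x (y :: p).
  by rewrite !walk_weight_cons lerD2l.
have lf : last x (y :: q) = last y p by [].
move: (y :: q) xq pf uf wf lf => f {q q1 q2 q3 q4}.
case/splitPr => qa qb; rewrite cat_path last_cat walk_weight_cat => /andP[pa /andP[ax pb]].
rewrite cat_uniq => /and3P[_ _ ub] wf lf; exists qb; split=> //.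
apply: le_trans wf; rewrite walk_weight_cons addrA lerDr.
by rewrite addr_ge0 ?walk_weight_ge0 // ltW // weight_gt0.
Qed.

Definition shortest x p : Prop :=
  path (adj G) x p /\ forall q, path (adj G) x q -> last x q = last x p ->
    walk_weight G x p <= walk_weight G x q.

(** Walks reduce to repetition-free ones of no larger weight. These have at most [#|U|] steps, so
    the infimum is a minimum over a finite type. *)
Lemma exists_shortest x y : connect (adj G) x y ->
  exists2 p, shortest x p & last x p = y.
Proof.
move=> /connectP[p0 p0P ->]; have [p1 [p1P l1 u1 w1]] := walk_uniq p0P.
have sz p : uniq (x :: p) -> (size p <= #|U|)%N.
  by move=> /card_uniqP e; rewrite -ltnS -[(size p).+1]e ltnW // ltnS max_card.
pose P (b : {bseq #|U| of U}) := path (adj G) x b && (last x b == last x p0).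
have P1 : P (Bseq (sz _ u1)) by rewrite /P /= p1P l1 eqxx.
case: (arg_minP (fun b : {bseq #|U| of U} => walk_weight G x b) P1) => b /andP[pb /eqP lb] hb.
exists (b : seq U) => //; split=> // q qP lq.
have [q' [q'P l' u' w']] := walk_uniq qP.
apply: le_trans w'; apply: (hb (Bseq (sz _ u'))).
by rewrite /P /= q'P l' lq lb eqxx.
Qed.

Lemma dist_shortest x p : shortest x p ->
  dist G x (last x p) = (walk_weight G x p)%:E.
Proof.
move=> [pP hp]; apply/eqP; rewrite eq_le; apply/andP; split.
  by apply: ereal_inf_lbound; exists p.
by apply/ereal_infP => _ [q [qP lq] <-]; rewrite lee_fin hp.
Qed.

Lemma dist_le_walk x p : path (adj G) x p ->
  (dist G x (last x p) <= (walk_weight G x p)%:E)%E.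
Proof. by move=> pP; apply: ereal_inf_lbound; exists p. Qed.

Lemma dist_ge x y (r : R) :
  (forall p, path (adj G) x p -> last x p = y -> r <= walk_weight G x p) ->
  (r%:E <= dist G x y)%E.
Proof. by move=> h; apply/ereal_infP => _ [q [qP lq] <-]; rewrite lee_fin h. Qed.

Definition rdist x y : R := fine (dist G x y).

Hypothesis connG : graph_connected G.
Local Notation d := rdist.
Local Notation V := (verts G).

Lemma rdist_shortest x y : x \in V -> y \in V ->
  exists2 p, shortest x p & last x p = y /\ d x y = walk_weight G x p.
Proof.
move=> xV yV; have [p sp <-] := exists_shortest (connG xV yV).
by exists p => //; rewrite /rdist dist_shortest.
Qed.

Lemma distE x y : x \in V -> y \in V -> dist G x y = (d x y)%:E.
Proof.
by move=> xV yV; have [p sp [<- _]] := rdist_shortest xV yV; rewrite /rdist dist_shortest.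
Qed.

Lemma path_verts x p : x \in V -> path (adj G) x p -> last x p \in V.
Proof.
by elim: p x => [|y p IH] x //= xV /andP[/adj_verts[_ yV _]]; apply: IH.
Qed.

Lemma rdist_le_walk x p : x \in V -> path (adj G) x p ->
  d x (last x p) <= walk_weight G x p.
Proof.
by move=> xV pP; rewrite -lee_fin -distE ?dist_le_walk // path_verts.
Qed.

Lemma rdist_ge0 x y : x \in V -> y \in V -> 0 <= d x y.
Proof.
by move=> xV yV; have [p [pP _] [_ ->]] := rdist_shortest xV yV; exact: walk_weight_ge0.
Qed.

Lemma rdist_refl x : x \in V -> d x x = 0.
Proof.
move=> xV; apply/eqP; rewrite eq_le rdist_ge0 // andbT.
by have := @rdist_le_walk x [::] xV isT; rewrite walk_weight_nil.
Qed.

Lemma rdist_eq0 x y : x \in V -> y \in V -> d x y <= 0 -> x = y.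
Proof.
move=> xV yV; have [[|z p] [pP _] [<- ->]] := rdist_shortest xV yV => //.
move: pP => /= /andP[xz zp]; rewrite walk_weight_cons => h.
by exfalso; have := weight_gt0 xz; have := walk_weight_ge0 zp; lra.
Qed.

Lemma rdist_sym x y : x \in V -> y \in V -> d x y = d y x.
Proof.
move=> xV yV; apply/eqP; rewrite eq_le.
have H u v : u \in V -> v \in V -> d u v <= d v u.
  move=> uV vV; have [p [pP _] [lp ->]] := rdist_shortest vV uV.
  have [q [qP lq <-]] := walk_rev pP; rewrite lp in qP lq *.
  by rewrite -[X in d _ X]lq rdist_le_walk.
by rewrite !H.
Qed.

Lemma rdist_tri y x z : x \in V -> y \in V -> z \in V -> d x z <= d x y + d y z.
Proof.
move=> xV yV zV; have [p [pP _] [lp ->]] := rdist_shortest xV yV.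
have [q [qP _] [lq ->]] := rdist_shortest yV zV.
have := @rdist_le_walk x (p ++ q) xV.
by rewrite cat_path last_cat walk_weight_cat pP lp qP lq; apply.
Qed.

Lemma rdist_edge x y : adj G x y -> d x y <= weight G [set x; y]%SET.
Proof.
move=> xy; have [xV _ _] := adj_verts xy.
by have := @rdist_le_walk x [:: y] xV; rewrite /= xy walk_weight_cons walk_weight_nil addr0; apply.
Qed.

(** [q] follows a shortest walk and stays at [y] after its end. The last clause holds because
    prefixes of a shortest walk are shortest. *)
Lemma geodesic x y : x \in V -> y \in V ->
  exists n (q : nat -> U), [/\ q 0%N = x, q n = y,
    forall i, (i < n)%N -> adj G (q i) (q i.+1),
    forall i, q i \in V &
    forall i j, (i <= j)%N -> d (q i) (q j) <= d x (q j) - d x (q i)].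
Proof.
move=> xV yV; have [p [pP hp] [lp dp]] := rdist_shortest xV yV.
exists (size p), (fun i => last x (take i p)); split.
- by rewrite take0.
- by rewrite take_size.
- move=> i ip; rewrite (take_nth x) // last_rcons.
  by move: pP; rewrite -{1}(cat_take_drop i.+1 p) cat_path (take_nth x) // rcons_path => /andP[/andP[_]].
- by move=> i; apply: path_verts => //; apply: take_path.
have qV i : last x (take i p) \in V by apply: path_verts => //; apply: take_path.
have dq i : d x (last x (take i p)) = walk_weight G x (take i p).
  apply/eqP; rewrite eq_le rdist_le_walk ?take_path //=.
  have [r [rP _] [lr ->]] := rdist_shortest xV (qV i).
  move: pP hp; rewrite -{1 2 3}(cat_take_drop i p) cat_path last_cat walk_weight_cat.
  move=> /andP[p1 p2] /(_ (r ++ drop i p)).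
  rewrite cat_path rP last_cat lr p2 walk_weight_cat lr lerD2r; exact.
move=> i j ij; rewrite !dq.
have -> : take j p = take i p ++ take (j - i) (drop i p).
  by rewrite -{1}(subnKC ij) takeD.
rewrite walk_weight_cat last_cat addrC addKr; apply: rdist_le_walk; first exact: qV.
move: pP; rewrite -{1}(cat_take_drop i p) cat_path => /andP[_].
by rewrite -{1}(cat_take_drop (j - i) (drop i p)) cat_path => /andP[].
Qed.

(** * Distance to the set of terminals *)

Variables (T : {set U}) (t0 : U).
Hypotheses (TV : T \subset V) (t0T : t0 \in T).

Definition nearest v := [arg min_(t < t0 in T) d v t]%O.
Definition tdist v := d v (nearest v).

Lemma tdistP v : nearest v \in T /\ forall t, t \in T -> tdist v <= d v t.
Proof. by rewrite /tdist /nearest; case: arg_minP. Qed.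

Lemma nearestV v : nearest v \in V.
Proof. by apply: (fintype.subsetP TV); case: (tdistP v). Qed.

Lemma tdist_ge0 v : v \in V -> 0 <= tdist v.
Proof. by move=> vV; rewrite rdist_ge0 ?nearestV. Qed.

Lemma tdist_terminal t : t \in T -> tdist t = 0.
Proof.
move=> tT; have tV := fintype.subsetP TV _ tT.
apply/eqP; rewrite eq_le tdist_ge0 // andbT -(rdist_refl tV).
by case: (tdistP t) => _; apply.
Qed.

Lemma tdist_lip u v : u \in V -> v \in V -> tdist u <= d u v + tdist v.
Proof.
move=> uV vV; have [nT _] := tdistP v.
by apply: le_trans (rdist_tri uV vV (nearestV v)); case: (tdistP u) => _; apply.
Qed.

(** The witness is the first step of a shortest walk to the nearest terminal. *)
Lemma tdist_pred v : v \in V -> v \notin T ->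
  exists u, [/\ adj G u v, d u v + tdist u <= tdist v & tdist u < tdist v].
Proof.
move=> vV vT; have [p [pP hp] [lp dp]] := rdist_shortest vV (nearestV v).
have [nT _] := tdistP v.
case: p pP lp dp {hp} => [|u p] /= ; first by move=> _ e; rewrite e nT in vT.
move=> /andP[vu pP] lp dp; have [_ uV vu'] := adj_verts vu.
have h1 : d u v <= weight G [set v; u]%SET.
  by rewrite rdist_sym // rdist_edge.
have h2 : tdist u <= walk_weight G u p.
  apply: le_trans (rdist_le_walk uV pP); rewrite lp.
  by case: (tdistP u) => _; apply.
have h3 : 0 < d u v.
  by rewrite ltNge; apply: contra vu' => /(rdist_eq0 uV vV) ->.
exists u; rewrite adj_sym vu; move: dp; rewrite -/(tdist v) walk_weight_cons => ->.
by split=> //; lra.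
Qed.

End Distance.

(** * Contracting the fibers of a map *)

Section Quotient.
Variable U : finType.
Implicit Types (H : graph U) (f : U -> U).

Lemma graph_eq H H' : verts H = verts H' -> edges H = edges H' -> H = H'.
Proof.
case: H => V E p; case: H' => V' E' p' /= eV eE; subst.
by congr Graph; exact: bool_irrelevance.
Qed.

Lemma edge_verts H e : e \in edges H -> e \subset verts H /\ #|e| = 2.
Proof. by move=> eH; have /forallP/(_ e) := edgesP H; rewrite eH => /andP[-> /eqP]. Qed.

Fact quotient_subproof H f : [forall e in
    [set (f @: (e : {set U}))%SET | e in edges H & #|(f @: (e : {set U}))%SET| == 2]%SET,
  (e \subset (f @: verts H)%SET) && (#|e| == 2)].
Proof.
apply/forall_inP => e0 /imsetP[e]; rewrite inE => /andP[eH c2] ->; rewrite c2 andbT.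
by apply: imsetS; have [] := edge_verts eH.
Qed.

Definition quotient_graph H f : graph U := Graph (quotient_subproof H f).

Lemma adj_quotient H f x y :
  reflect (exists u v, [/\ adj H u v, f u = x, f v = y & x != y])
          (adj (quotient_graph H f) x y).
Proof.
apply: (iffP idP) => [|[u [v [uv <- <- ne]]]]; last first.
  apply/imsetP; exists [set u; v]%SET; last by rewrite imsetU1 imset_set1.
  by rewrite inE -/(adj H u v) uv /= imsetU1 imset_set1 cards2 ne.
move=> xy; have [e] := imsetP xy; rewrite inE => /andP[eH /eqP c2] exy.
have nxy : x != y by move: c2; rewrite -exy cards2; case: eqP.
have [_ /eqP/cards2P[u [v [uv ee]]]] := edge_verts eH.
move: exy; rewrite ee imsetU1 imset_set1 => exy.
have : x \in [set f u; f v]%SET by rewrite -exy !inE eqxx.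
have : y \in [set f u; f v]%SET by rewrite -exy !inE eqxx orbT.
rewrite !inE => /orP[]/eqP ey /orP[]/eqP ex; try by rewrite ex ey eqxx in nxy.
  by exists v, u; rewrite /adj finset.setUC -ee.
by exists u, v; rewrite /adj -ee.
Qed.

Lemma connect_homo (e e' : rel U) (h : U -> U) x y :
  (forall a b, e a b -> connect e' (h a) (h b)) ->
  connect e x y -> connect e' (h x) (h y).
Proof.
move=> he /connectP[p]; elim: p x => [|z p IH] x /=; first by move=> _ ->.
by move=> /andP[xz zp] /(IH _ zp); apply: connect_trans; apply: he.
Qed.

Definition fiber_adj H f : rel U := fun a b => adj H a b && (f a == f b).

Fact contract_subproof H u v : adj H u v -> [forall e in
    [set (Defs.merge u v @: (e : {set U}))%SET | e in edges H :\ [set u; v]]%SET,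
  (e \subset (verts H :\ v)%SET) && (#|e| == 2)].
Proof.
move=> uv; have [uvV /eqP] := edge_verts uv; rewrite cards2.
have [//|nuv _] := eqVneq u v.
apply/forall_inP => e0 /imsetP[e]; rewrite in_setD1 => /andP[ne eH] ->.
have [eV /eqP/cards2P[a [b [nab ee]]]] := edge_verts eH.
move: uvV eV ne; rewrite ee !finset.subUset !finset.sub1set imsetU1 imset_set1.
move=> /andP[uV vV] /andP[aV bV] ne.
have mV c : c \in verts H -> Defs.merge u v c \in (verts H :\ v)%SET.
  by rewrite /Defs.merge !inE; have [_ _|-> ->] := eqVneq c v; rewrite ?nuv.
rewrite finset.subUset !finset.sub1set !mV //= cards2.
suff -> : Defs.merge u v a != Defs.merge u v b by [].
rewrite /Defs.merge; have [ea|na] := eqVneq a v; have [eb|nb] := eqVneq b v => //.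
- by rewrite ea eb eqxx in nab.
- by apply: contra ne => /eqP <-; rewrite ea finset.setUC.
- by apply: contra ne => /eqP ->; rewrite eb.
Qed.

Definition contract H u v (uv : adj H u v) : graph U := Graph (contract_subproof uv).

(** Induction on the number of vertices moved by [f]. The first edge of a fiber path from a moved
    [v] to [f v] leads to some [u] with the same image; contracting it preserves the quotient and
    the connectedness of the fibers. *)
Lemma quotient_minor G H f : minor G H ->
  (forall v, v \in verts H ->
     [/\ f v \in verts H, f (f v) = f v & connect (fiber_adj H f) v (f v)]) ->
  minor G (quotient_graph H f).
Proof.
have [n] := ubnP #|[set v in verts H | f v != v]%SET|.
elim: n H => [//|n IH] H; rewrite ltnS => cn GH hf.
have [fix0|[v]] := finset.set_0Vmem [set v in verts H | f v != v]%SET.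
  have fid v : v \in verts H -> f v = v.
    by move=> vH; have := finset.in_set0 v; rewrite -fix0 inE vH /= => /negbFE/eqP.
  have fE e : e \in edges H -> (f @: e)%SET = e.
    move=> eH; have [eV _] := edge_verts eH.
    rewrite -[RHS]imset_id; apply: eq_in_imset => x xe.
    by rewrite fid //; apply: (fintype.subsetP eV).
  suff -> : quotient_graph H f = H by [].
  apply: graph_eq => /=.
    by rewrite -[RHS]imset_id; apply: eq_in_imset => x xe; rewrite fid.
  apply/finset.setP => e; apply/imsetP/idP => [[e']|eH].
    by rewrite inE => /andP[eH _] ->; rewrite fE.
  by exists e; rewrite ?inE ?eH ?fE //=; have [_ ->] := edge_verts eH.
rewrite inE => /andP[vV nfv].
have [fV ffv /connectP[p]] := hf _ vV.
case: p => [|u p] /=; first by move=> _ e; rewrite e eqxx in nfv.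
move=> /andP[/andP[vu /eqP fvu] _] _.
have uv : adj H u v by rewrite /adj finset.setUC.
have [uvV /eqP] := edge_verts uv; rewrite cards2.
have [//|nuv _] := eqVneq u v.
have uV : u \in verts H by apply: (fintype.subsetP uvV); rewrite !inE eqxx.
have fm x : f (Defs.merge u v x) = f x by rewrite /Defs.merge; case: eqP => // ->.
pose H' := contract uv.
have GH' : minor G H' by apply: minor_next GH _; exact: (EdgeContraction uv).
have -> : quotient_graph H f = quotient_graph H' f.
  apply: graph_eq => /=.
    apply/finset.setP => y; apply/imsetP/imsetP => [[x xV ->]|[x]].
      exists (Defs.merge u v x) => //; rewrite !inE /Defs.merge.
      by have [_|-> //] := eqVneq x v; rewrite nuv uV.
    by rewrite inE => /andP[_ xV] ->; exists x.
  have fme (e : {set U}) : (f @: (Defs.merge u v @: e))%SET = (f @: e)%SET.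
    by rewrite -imset_comp; apply: eq_imset => x /=; rewrite fm.
  apply/finset.setP => e; apply/imsetP/imsetP => [[e']|[e']].
    rewrite inE => /andP[eH c2] ->; exists (Defs.merge u v @: e')%SET; last by rewrite fme.
    rewrite inE fme c2 andbT; apply/imsetP; exists e' => //; rewrite !inE eH andbT.
    apply: contraL c2 => /eqP ->; rewrite imsetU1 imset_set1 -fvu cards2 eqxx.
    by [].
  rewrite inE => /andP[/imsetP[e'']]; rewrite inE => /andP[_ eH] ->.
  by rewrite fme => c2 ->; exists e''; rewrite ?inE ?eH.
apply: IH GH' _.
  apply: leq_trans cn; apply: proper_card; apply/fintype.properP; split.
    by apply/fintype.subsetP => x; rewrite !inE => /andP[/andP[_ ->] ->].
  by exists v; rewrite !inE ?vV ?eqxx.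
move=> w; rewrite !inE => /andP[wv wV]; have [fwV ffw cw] := hf _ wV.
(* The vertex that disappears represents no fiber. *)
have nfw : f w != v by apply: contra nfv => /eqP <-; rewrite ffw.
split=> //; first by rewrite nfw.
have mw x : x != v -> Defs.merge u v x = x by rewrite /Defs.merge => /negPf ->.
rewrite -[X in connect _ X](mw w) // -[X in connect _ _ X](mw (f w)) //.
apply: connect_homo cw => a b /andP[ab /eqP fab].
have [e|ne] := eqVneq [set a; b]%SET [set u; v]%SET; last first.
  apply: connect1; rewrite /fiber_adj !fm fab eqxx andbT.
  apply/imsetP; exists [set a; b]%SET; first by rewrite !inE ne.
  by rewrite imsetU1 imset_set1.
have m x : x \in [set u; v]%SET -> Defs.merge u v x = u.
  by rewrite !inE /Defs.merge => /orP[]/eqP ->; rewrite ?eqxx //; case: eqP.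
by rewrite !m -?e ?inE ?eqxx ?orbT.
Qed.

End Quotient.

(** * Growing clusters *)

Section Clustering.
Variables (R : realType) (U : finType) (G : wgraph R U) (T : {set U}) (t0 : U).
Hypotheses (connG : graph_connected G) (TV : T \subset verts G) (t0T : t0 \in T).

Local Notation d := (rdist G).
Local Notation V := (verts G).
Local Notation td := (tdist G T t0).

Let tV t : t \in T -> t \in V. Proof. exact: (fintype.subsetP TV). Qed.

Implicit Types (f : U -> option U) (t : U) (rho : R).

Definition candidate f t rho : pred U :=
  fun v => [&& v \in V, f v == None & d v t <= rho * td v].

Definition cluster f t rho : pred U :=
  connect (fun a b => [&& adj G a b, candidate f t rho a & candidate f t rho b]) t.

Definition claim f t rho : U -> option U :=
  fun v => if cluster f t rho v then Some t else f v.

Definition fiber f (s : U) : rel U :=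
  fun a b => [&& adj G a b, f a == Some s & f b == Some s].

(** The invariant after processing [S]. Its last clause, closure away from the terminals along
    shortest routes, is what forces every vertex to be claimed in the end. *)
Definition claimed_by f (S : seq U) : Prop :=
  [/\ forall v s, f v = Some s ->
        [/\ v \in V, s \in S, d v s <= 2 * td v & connect (fiber f s) s v],
      forall s, s \in S -> f s = Some s,
      forall s, s \in T -> s \notin S -> f s = None &
      forall u v, adj G u v -> d u v + td u <= td v -> f u <> None -> f v <> None].

Lemma cluster_candidate f t rho v : t \in T -> f t = None ->
  cluster f t rho v -> candidate f t rho v.
Proof.
move=> tT ft /connectP[p].
have ct : candidate f t rho t.
  by rewrite /candidate tV // ft rdist_refl ?tV // (tdist_terminal connG) ?mulr0 //=.
elim/last_ind: p => [_ ->//|p z _].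
by rewrite rcons_path last_rcons => /andP[_ /and3P[_ _ ?]] ->.
Qed.

Lemma cluster_extend f t rho u v : cluster f t rho u -> candidate f t rho u ->
  candidate f t rho v -> adj G u v -> cluster f t rho v.
Proof. by move=> tu cu cv uv; apply: connect_trans tu (connect1 _); rewrite uv cu. Qed.

Lemma cluster_mono f t rho rho' v : rho <= rho' -> cluster f t rho v -> cluster f t rho' v.
Proof.
move=> le_r; apply: connect_sub => a b /and3P[ab ca cb]; apply: connect1.
have H c : candidate f t rho c -> candidate f t rho' c.
  move=> /and3P[cV fc h]; rewrite /candidate cV fc /=; apply: le_trans h _.
  by rewrite ler_wpM2r // tdist_ge0.
by rewrite ab !H.
Qed.

Lemma claimed_by_nil : claimed_by (fun=> None) [::].
Proof. by split. Qed.

Lemma claimed_by_cons f S t rho : claimed_by f S -> t \in T -> t \notin S ->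
  1 <= rho <= 2 -> claimed_by (claim f t rho) (t :: S).
Proof.
move=> [h1 h2 h3 h4] tT tS /andP[r1 r2]; have ft := h3 _ tT tS.
have cc v : cluster f t rho v -> candidate f t rho v by apply: cluster_candidate.
have keep v s : f v = Some s -> claim f t rho v = Some s.
  by rewrite /claim; case: ifP => // /cc/and3P[_ /eqP ->].
split.
- move=> v s; rewrite {1}/claim; case: ifPn => [cv [<-]|_ /[dup] fv /h1[vV sS dv cv]].
    have /and3P[vV _ dv] := cc _ cv; split=> //; first exact: mem_head.
      by apply: le_trans dv _; rewrite ler_wpM2r // tdist_ge0.
    case/connectP: cv => p; elim/last_ind: p v vV dv => [v _ _ _ -> //|p z IH v vV dv].
    rewrite rcons_path last_rcons => /andP[pp /and3P[az ca cz]] ->.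
    have cl : cluster f t rho (last t p) by apply/connectP; exists p.
    have /and3P[lV _ ld] := ca.
    apply: connect_trans (IH _ lV ld pp erefl) (connect1 _).
    have clz : cluster f t rho z by apply: cluster_extend cl ca cz az.
    by rewrite /fiber /claim az cl clz eqxx.
  split=> //; first by rewrite inE sS orbT.
  apply: connect_sub cv => a b /and3P[ab /eqP fa /eqP fb]; apply: connect1.
  by rewrite /fiber ab (keep _ _ fa) (keep _ _ fb) eqxx.
- move=> s; rewrite inE => /orP[/eqP ->|/h2 fs]; last exact: keep.
  by rewrite /claim /cluster connect0.
- move=> s sT; rewrite inE negb_or => /andP[st /(h3 _ sT) fs].
  rewrite /claim; case: ifP => // /cc/and3P[_ _]; rewrite (tdist_terminal connG) // mulr0.
  by move=> /(rdist_eq0 connG (tV sT) (tV tT)) e; rewrite e eqxx in st.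
- move=> u v uv duv; rewrite /claim; case: ifPn => [cu _|_ fu]; last first.
    by case: ifP => // _; apply: h4 uv duv fu.
  case: ifPn => // ncv; case fv : (f v) => //; exfalso; move/negP: ncv; apply.
  have /and3P[uV _ du] := cc _ cu; have [_ vV _] := adj_verts uv.
  apply: (cluster_extend cu (cc _ cu)) uv.
  (* As [rho >= 1], d(v, t) <= d(u, v) + rho [td u] <= rho (d(u, v) + [td u]) <= rho [td v]. *)
  rewrite /candidate vV fv /=; apply: le_trans (rdist_tri connG vV uV (tV tT)) _.
  rewrite rdist_sym //; apply: le_trans (_ : rho * (d u v + td u) <= _); last first.
    by rewrite ler_wpM2l //; lra.
  by rewrite mulrDr lerD // ler_peMl // rdist_ge0.
Qed.

(** An unclaimed vertex closest to the terminals would have a claimed predecessor, and closure would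
    claim it too. *)
Lemma claimed_total f : claimed_by f (enum T) -> forall v, v \in V -> f v <> None.
Proof.
move=> [h1 h2 h3 h4] v vV fv.
pose P u := (u \in V) && (f u == None).
have Pv : P v by rewrite /P vV fv.
case: (arg_minP td Pv) => u /andP[uV /eqP fu] hu.
have [uT|uT] := boolP (u \in T); first by rewrite h2 ?mem_enum in fu.
have [w [wu dwu ltw]] := tdist_pred connG TV t0T uV uT.
have [wV _ _] := adj_verts wu.
apply: (h4 w u wu dwu _ fu) => fw.
have := hu w; rewrite /P wV fw eqxx => /(_ isT).
by rewrite leNgt ltw.
Qed.

(* The radius grows by [1 / m], which beats the loss of a move by [td u / (3 m)]. *)
Lemma candidate_near f t (m : nat) rho u v : t \in T -> (0 < m)%N ->
  1 <= rho -> rho + m%:R^-1 <= 2 -> candidate f t rho u -> v \in V -> f v = None ->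
  3 * m%:R * d u v <= td u -> candidate f t (rho + m%:R^-1) v.
Proof.
move=> tT m0 r1 r2 /and3P[uV _ du] vV fv duv.
rewrite /candidate vV fv /=.
have h1 := rdist_tri connG vV uV (tV tT); rewrite (rdist_sym connG vV uV) in h1.
have h2 := tdist_lip connG TV t0T uV vV.
have h3 := rdist_ge0 connG uV vV.
have mr : 0 < m%:R :> R by rewrite ltr0n.
have h4 : 3 * d u v <= m%:R^-1 * td u.
  by rewrite [leRHS]mulrC ler_pdivlMr // mulrAC.
set i := m%:R^-1 in r2 h4 *.
have i0 : 0 < i by rewrite invr_gt0.
have h5 : (rho + i) * (td u - d u v) <= (rho + i) * td v.
  by rewrite ler_wpM2l; lra.
have h6 : (rho + i) * d u v <= 2 * d u v by rewrite ler_wpM2r.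
lra.
Qed.

(** * Labelling a path between terminals *)

Section Path.
Variables (n : nat) (q : nat -> U).
Hypotheses (q_adj : forall i, (i < n)%N -> adj G (q i) (q i.+1))
  (qV : forall i, q i \in V)
  (q_geo : forall i j, (i <= j)%N -> d (q i) (q j) <= d (q 0%N) (q j) - d (q 0%N) (q i))
  (q0T : q 0%N \in T) (qnT : q n \in T).

Definition pos i := d (q 0%N) (q i).
Definition tpos i := td (q i).

Lemma profile_path : profile pos tpos.
Proof.
split=> [|i|i j ij]; first exact: tdist_terminal.
  exact: tdist_ge0.
apply: le_trans (q_geo ij).
have := tdist_lip connG TV t0T (qV i) (qV j).
have := tdist_lip connG TV t0T (qV j) (qV i).
rewrite (rdist_sym connG (qV j) (qV i)) ler_norml /tpos => ? ?.
by apply/andP; split; lra.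
Qed.

(** A label need not be the owner of the vertex: the two must agree only at the ends of a run of
    equal labels. Active vertices are unclaimed. *)
Definition labelling f (lab : nat -> option U) : Prop :=
  [/\ (forall s, lab 0%N = Some s -> f (q 0%N) = Some s) /\
      (forall s, lab n = Some s -> f (q n) = Some s),
      forall i s, (i < n)%N -> lab i.+1 = Some s -> lab i <> Some s -> f (q i.+1) = Some s,
      forall i s, (i < n)%N -> lab i = Some s -> lab i.+1 <> Some s -> f (q i) = Some s &
      forall i, (i <= n)%N -> lab i = None -> f (q i) = None].

Definition covered f t (m : nat) (lab : nat -> option U) (g : nat) : pred nat :=
  fun i => [&& (i <= n)%N, lab i == None & cluster f t (1 + g%:R / m%:R) (q i)].

Lemma labelling_claim f t m lab g : t \in T -> f t = None -> labelling f lab ->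
  labelling (claim f t (1 + g%:R / m%:R)) (relabel_hull n (covered f t m lab g) t lab).
Proof.
move=> tT ft [[h0 hn] hl hr hN]; set rho := 1 + _; set f' := claim f t rho.
have keep v s : f v = Some s -> f' v = Some s.
  rewrite /f' /claim; case: ifP => // /(cluster_candidate tT ft).
  by move=> /and3P[_ /eqP ->].
have new i : covered f t m lab g i -> f' (q i) = Some t.
  by move=> /and3P[_ _ ci]; rewrite /f' /claim ci.
have act i : (i <= n)%N -> lab i = None -> ~~ covered f t m lab g i -> f' (q i) = None.
  move=> i_n li; rewrite /covered i_n li eqxx /= => /negPf nc.
  by rewrite /f' /claim nc hN.
have cn i : covered f t m lab g i -> (i <= n)%N by move=> /and3P[].
case: (relabel_hullP t lab cn) => [[nc ->]|[a [b [ca cb hab ->]]]].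
  split; [split|..].
  - by move=> s /h0/keep.
  - by move=> s /hn/keep.
  - by move=> i s i_n h1 h2; apply/keep/(hl _ _ i_n).
  - by move=> i s i_n h1 h2; apply/keep/(hr _ _ i_n).
  - by move=> i i_n li; apply: act.
have ab : (a <= b)%N by have /andP[] := hab _ ca.
(* Both ends of the hull were active, so it cuts no earlier run of a terminal label. *)
have la : lab a = None by case/and3P: ca => _ /eqP.
have lb : lab b = None by case/and3P: cb => _ /eqP.
have bn := cn _ cb.
have inE' i : (a <= i <= b)%N -> relabel a b t lab i = Some t by rewrite /relabel => ->.
have outE i : (a <= i <= b)%N = false -> relabel a b t lab i = lab i.
  by rewrite /relabel => ->.
split; [split|..].
- move=> s; case E : (a <= 0 <= b)%N; last by rewrite outE // => /h0/keep.
  rewrite inE' // => -[<-]; rewrite (_ : 0%N = a) ?new //.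
  by move/andP: E => [+ _]; case: (a).
- move=> s; case E : (a <= n <= b)%N; last by rewrite outE // => /hn/keep.
  rewrite inE' // => -[<-]; rewrite (_ : n = b) ?new //.
  by apply/eqP; rewrite eqn_leq bn; case/andP: E => _ ->.
- move=> i s i_n; case E : (a <= i.+1 <= b)%N.
    rewrite inE' // => -[<-]; case E' : (a <= i <= b)%N; first by rewrite inE'.
    by move=> _; rewrite (_ : i.+1 = a) ?new //; move: E E'; clear; lia.
  rewrite outE // => li; case E' : (a <= i <= b)%N; last first.
    by rewrite outE // => h; apply/keep/(hl _ _ i_n).
  move=> _; apply/keep/(hl _ _ i_n) => //.
  by rewrite (_ : i = b) ?lb //; move: E E'; clear; lia.
- move=> i s i_n; case E : (a <= i <= b)%N.
    rewrite inE' // => -[<-]; case E' : (a <= i.+1 <= b)%N; first by rewrite inE'.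
    by move=> _; rewrite (_ : i = b) ?new //; move: E E'; clear; lia.
  rewrite outE // => li; case E' : (a <= i.+1 <= b)%N; last first.
    by rewrite outE // => h; apply/keep/(hr _ _ i_n).
  move=> _; apply/keep/(hr _ _ i_n) => //.
  by rewrite (_ : i.+1 = a) ?la //; move: E E'; clear; lia.
- move=> i i_n; case E : (a <= i <= b)%N; first by rewrite inE'.
  rewrite outE // => li; apply: act => //; apply/negP => /hab.
  by rewrite E.
Qed.

Lemma geometric_law_mean_claim f t (m : nat) lab (lam : R) :
  t \in T -> f t = None -> labelling f lab -> (0 < m)%N ->
  0 <= lam -> lam * (96 * d (q 0%N) (q n)) <= 1 ->
  geometric_law_mean m (fun g => expR (lam *
    potential (100 * m%:R) pos tpos (relabel_hull n (covered f t m lab g) t lab) n)) <=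
  (1 + (3 / 4) ^+ m) * expR (lam * potential (100 * m%:R) pos tpos lab n).
Proof.
move=> tT ft [_ _ _ hN] m0 lam0 lamL.
have mr : 0 < m%:R :> R by rewrite ltr0n.
have rS g : 1 + g.+1%:R / m%:R = 1 + g%:R / m%:R + m%:R^-1 :> R.
  by rewrite -natr1 mulrDl mul1r addrA.
have r1 g : 1 <= 1 + g%:R / m%:R :> R by rewrite lerDl divr_ge0.
have near g i l : (g < m)%N -> cluster f t (1 + g%:R / m%:R) (q i) -> (l <= n)%N ->
    lab l = None -> 3 * m%:R * d (q i) (q l) <= td (q i) ->
    candidate f t (1 + g.+1%:R / m%:R) (q l).
  move=> gm /(cluster_candidate tT ft) ci ln ll hd; rewrite rS.
  apply: (candidate_near tT m0 (r1 g) _ ci) => //; last exact: hN.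
  by rewrite -rS -[leRHS]/(1 + 1) lerD2l ler_pdivrMr // mul1r ler_nat.
have mono g i : cluster f t (1 + g%:R / m%:R) (q i) -> cluster f t (1 + g.+1%:R / m%:R) (q i).
  by apply: cluster_mono; rewrite rS lerDl invr_ge0.
apply: geometric_law_mean_potential => //.
- exact: profile_path.
- exact: tdist_terminal.
- by move=> g i /and3P[i_n li ci]; rewrite /covered i_n li mono.
- by move=> g i /and3P[i_n /eqP].
- move=> g i h gm /and3P[i_n _ ci] hi hact hd.
  have cand l : (h <= l <= i)%N -> candidate f t (1 + g.+1%:R / m%:R) (q l).
    move=> hl; have /andP[hl1 hl2] := hl.
    apply: (near _ i) => //; [exact: leq_trans hl2 i_n|exact: hact|].
    apply: le_trans hd; rewrite ler_pM2l ?mulr_gt0 // (rdist_sym connG) //.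
    apply: le_trans (q_geo hl2) _; rewrite lerD2l lerN2.
    by have := q_geo hl1; have := rdist_ge0 connG (qV h) (qV l); rewrite /pos; lra.
  rewrite /covered (leq_trans hi) // hact ?leqnn //=.
  (* All vertices from [h] to [i] are candidates, so the cluster spreads along the path from [i]
     back to [h]. *)
  have H k : (k <= i - h)%N -> cluster f t (1 + g.+1%:R / m%:R) (q (i - k)%N).
    elim: k => [|k IH] hk; first by rewrite subn0 mono.
    have e : ((i - k) = (i - k.+1).+1)%N by move: hk; clear; lia.
    apply: (cluster_extend (IH (ltnW hk))); try (apply: cand; move: hk hi; clear; lia).
    by rewrite adj_sym e; apply: q_adj; move: hk i_n; clear; lia.
  by have := H _ (leqnn _); rewrite subKn.
- move=> g i h gm /and3P[i_n _ ci] hi hn hact hd.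
  have cand l : (i <= l <= h)%N -> candidate f t (1 + g.+1%:R / m%:R) (q l).
    move=> hl; have /andP[hl1 hl2] := hl.
    apply: (near _ i) => //; [exact: leq_trans hl2 hn|exact: hact|].
    apply: le_trans hd; rewrite ler_pM2l ?mulr_gt0 //.
    apply: le_trans (q_geo hl1) _; rewrite lerD2r.
    by have := q_geo hl2; have := rdist_ge0 connG (qV l) (qV h); rewrite /pos; lra.
  rewrite /covered hn hact ?leqnn ?hi //=.
  have H k : (k <= h - i)%N -> cluster f t (1 + g.+1%:R / m%:R) (q (i + k)%N).
    elim: k => [|k IH] hk; first by rewrite addn0 mono.
    apply: (cluster_extend (IH (ltnW hk))); try (apply: cand; move: hk hi; clear; lia).
    by rewrite addnS; apply: q_adj; move: hk hn hi; clear; lia.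
  by have := H _ (leqnn _); rewrite subnKC.
- by rewrite /pos (rdist_refl connG (qV _)) subr0.
Qed.

End Path.
End Clustering.

(** * Choosing the radii *)

Definition terminal_geodesic (R : realType) (U : finType) (G : wgraph R U)
    (T : {set U}) (n : nat) (q : nat -> U) : Prop :=
  [/\ forall i, (i < n)%N -> adj G (q i) (q i.+1),
      forall i, q i \in verts G,
      forall i j, (i <= j)%N ->
        rdist G (q i) (q j) <= rdist G (q 0%N) (q j) - rdist G (q 0%N) (q i),
      q 0%N \in T /\ q n \in T &
      0 < rdist G (q 0%N) (q n)].

Lemma exists_clustering (R : realType) (U : finType) (G : wgraph R U)
    (T : {set U}) (t0 : U) (I : finType) (P : pred I) (n : I -> nat)
    (q : I -> nat -> U) (m : nat) :
  graph_connected G -> T \subset verts G -> t0 \in T -> (0 < m)%N ->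
  (forall p, P p -> terminal_geodesic G T (n p) (q p)) ->
  let lam p := (96 * rdist G (q p 0%N) (q p (n p)))^-1 in
  let Phi lab p :=
    potential (100 * m%:R) (pos G (q p)) (tpos G T t0 (q p)) (lab p) (n p) in
  exists f (lab : I -> nat -> option U),
    [/\ claimed_by G T t0 f (enum T),
        forall p, P p -> labelling (n p) (q p) f (lab p) &
        \sum_(p | P p) expR (lam p * Phi lab p) <=
        (1 + (3 / 4) ^+ m) ^+ #|T| *
        \sum_(p | P p) expR (lam p * Phi (fun=> fun=> None) p)].
Proof.
move=> connG TV t0T m0 hP lam Phi.
have mr : 0 < m%:R :> R by rewrite ltr0n.
suff H (S : seq U) : uniq S -> {subset S <= T} ->
  exists f (lab : I -> nat -> option U),
    [/\ claimed_by G T t0 f S,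
        forall p, P p -> labelling (n p) (q p) f (lab p) &
        \sum_(p | P p) expR (lam p * Phi lab p) <=
        (1 + (3 / 4) ^+ m) ^+ size S *
        \sum_(p | P p) expR (lam p * Phi (fun=> fun=> None) p)].
  by rewrite cardE; apply: H; [exact: enum_uniq|move=> x; rewrite mem_enum].
elim: S => [|t S IH] /=.
  move=> _ _; exists (fun=> None), (fun=> fun=> None); split.
  - exact: claimed_by_nil.
  - by [].
  - by rewrite expr0 mul1r.
move=> /andP[tS uS] sT.
have [|f [lab [fS flab flam]]] := IH uS; first by move=> x xS; rewrite sT // inE xS orbT.
have tT : t \in T by rewrite sT ?mem_head.
have ft : f t = None by case: fS => _ _ h _; apply: h.
pose lab' g p := relabel_hull (n p) (covered G T t0 (n p) (q p) f t m (lab p) g) t (lab p).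
(* Averaging the sum over all pairs yields one radius that serves them simultaneously. *)
have [g gm hg] := geometric_law_mean_ge m (fun g => \sum_(p | P p) expR (lam p * Phi (lab' g) p)).
exists (claim G T t0 f t (1 + g%:R / m%:R)), (lab' g); split.
- apply: (claimed_by_cons connG TV t0T fS tT tS).
  rewrite lerDl divr_ge0 //= -[leRHS]/(1 + 1) lerD2l ler_pdivrMr // mul1r.
  by rewrite ler_nat.
- by move=> p /flab; apply: labelling_claim.
- apply: le_trans hg _; rewrite geometric_law_mean_sum.
  have q0 : 0 <= 1 + (3 / 4) ^+ m :> R by rewrite addr_ge0 // exprn_ge0 //; lra.
  rewrite exprS -mulrA; apply: le_trans (ler_wpM2l q0 flam); rewrite mulr_sumr.
  apply: ler_sum => p Pp; have [h1 h2 h3 [h4 h5] h6] := hP p Pp.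
  apply: (geometric_law_mean_claim connG TV t0T h1 h2 h3 h4 h5 tT ft (flab p Pp) m0).
    by rewrite invr_ge0 mulr_ge0 // ltW.
  by rewrite mulVf // mulf_neq0 ?gt_eqF.
Qed.

(** * The contracted graph and its distances *)

Section Contraction.
Variables (R : realType) (U : finType) (G : wgraph R U) (T : {set U}) (t0 : U).
Variable f : U -> option U.
Hypotheses (connG : graph_connected G) (TV : T \subset verts G) (t0T : t0 \in T)
  (fT : claimed_by G T t0 f (enum T)).
Local Notation d := (rdist G).
Local Notation V := (verts G).

Let tV t : t \in T -> t \in V. Proof. exact: (fintype.subsetP TV). Qed.

Definition owner v := odflt v (f v).

(** The weight of an unordered pair must be symmetric in its elements; the halved double sum counts
    d(x, y) twice, and the diagonal vanishes. *)
Definition pair_weight (e : {set U}) : R :=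
  (\sum_(x in e) \sum_(y in e) d x y) / 2.

Lemma pair_weightE x y : x \in V -> y \in V -> x != y ->
  pair_weight [set x; y]%SET = d x y.
Proof.
move=> xV yV xy; have e (F : U -> R) : \sum_(z in [set x; y]%SET) F z = F x + F y.
  by rewrite big_setU1 ?inE //= big_set1.
rewrite /pair_weight !e !(rdist_refl connG) // (rdist_sym connG yV xV); lra.
Qed.

Lemma owner_claim v : v \in V ->
  [/\ f v = Some (owner v), owner v \in T & d v (owner v) <= 2 * tdist G T t0 v].
Proof.
move=> vV; have := claimed_total connG TV t0T fT vV; rewrite /owner.
case fv : (f v) => [s|] // _; case: fT => /(_ v s fv)[_ + dv _] _ _ _.
by rewrite mem_enum.
Qed.

Lemma owner_terminal t : t \in T -> owner t = t.
Proof. by move=> tT; case: fT => _ h _ _; rewrite /owner h ?mem_enum. Qed.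

Lemma contraction_verts : verts (quotient_graph G owner) = T.
Proof.
apply/finset.setP => t; apply/imsetP/idP => [[v vV ->]|tT].
  by have [] := owner_claim vV.
by exists t; rewrite ?owner_terminal // tV.
Qed.

Lemma pair_weight_gt0 e : e \in edges (quotient_graph G owner) -> 0 < pair_weight e.
Proof.
move=> eE; have [eT /eqP/cards2P[x [y [xy ee]]]] := edge_verts eE.
move: eT; rewrite contraction_verts ee finset.subUset !finset.sub1set => /andP[xT yT].
rewrite pair_weightE ?tV // ltNge; apply: contra xy => h.
by rewrite (rdist_eq0 connG _ _ h) ?tV.
Qed.

Definition contraction : wgraph R U := WGraph pair_weight_gt0.

Lemma contraction_minor : minor G contraction.
Proof.
apply: quotient_minor => [|v vV]; first exact: minor_refl.
have [fv oT _] := owner_claim vV; split; [exact: tV|exact: owner_terminal|].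
case: fT => /(_ _ _ fv)[_ _ _ c] _ _ _.
have sym : connect_sym (fiber_adj G owner).
  by apply: sym_connect_sym => a b; rewrite /fiber_adj adj_sym eq_sym.
rewrite sym; apply: connect_sub c => a b /and3P[ab /eqP fa /eqP fb].
by apply: connect1; rewrite /fiber_adj /owner ab fa fb /=.
Qed.

(** Every edge weighs the distance of its ends in [G], so the triangle inequality applies along any
    walk. *)
Lemma contraction_dist_ge s t : s \in T -> t \in T ->
  (dist G s t <= dist contraction s t)%E.
Proof.
move=> sT tT; rewrite distE ?tV //; apply: dist_ge => p.
elim: p s sT => [|z p IH] s sT /=.
  by move=> _ <-; rewrite (rdist_refl connG) ?tV // walk_weight_nil.
move=> /andP[sz zp] lp; have [_ zT ne] := @adj_verts _ _ contraction s z sz.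
rewrite contraction_verts in zT.
rewrite walk_weight_cons /= pair_weightE ?tV //.
apply: le_trans (rdist_tri connG (tV sT) (tV zT) (tV tT)) _.
by rewrite lerD2l IH.
Qed.

(** The successive labels spell a walk. At a label change both vertices belong to their label's
    cluster, so the clusters are adjacent, and the new edge weighs at most the step of the path plus
    twice [tdist] at each of its ends, which is the edge potential. *)
Lemma contraction_dist_le (M : R) n q lab : 14 <= M ->
  terminal_geodesic G T n q -> labelling n q f lab ->
  (dist contraction (q 0%N) (q n) <=
   (potential M (pos G q) (tpos G T t0 q) lab n + d (q 0%N) (q n))%:E)%E.
Proof.
move=> M14 [q_adj qV q_geo [q0T qnT] _] [[l0 ln] hl hr hN].
have xD : profile (pos G q) (tpos G T t0 q) by exact: (profile_path connG TV t0T).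
have lab_some i : (i <= n)%N -> exists s, lab i = Some s.
  move=> i_n; case li : (lab i) => [s|]; first by exists s.
  by have [] := claimed_total connG TV t0T fT (qV i) (hN i i_n li).
have fown v s : f v = Some s -> owner v = s by rewrite /owner => ->.
suff H i : (i <= n)%N -> exists p, [/\ path (adj contraction) (q 0%N) p,
    lab i = Some (last (q 0%N) p) &
    walk_weight contraction (q 0%N) p <=
    potential M (pos G q) (tpos G T t0 q) lab i + pos G q i].
  have [p [pP lp wp]] := H n (leqnn n).
  have e : last (q 0%N) p = q n.
    by have := fown _ _ (ln _ lp); rewrite owner_terminal.
  by rewrite -{1}e; apply: le_trans (dist_le_walk pP) _; rewrite lee_fin.
elim: i => [|i IH] i_n.
  exists [::]; split=> //.
    have [s ls] := lab_some 0%N isT.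
    by have := fown _ _ (l0 _ ls); rewrite owner_terminal // => ->.
  by rewrite walk_weight_nil /potential big_ord0 add0r /pos (rdist_refl connG).
have [p [pP lp wp]] := IH (ltnW i_n).
have [s ls] := lab_some i.+1 i_n.
have e0 := edge_potential_ge0 lab xD M14 i.
have dx := q_geo _ _ (leqnSn i).
have x0 : pos G q i <= pos G q i.+1.
  by have := rdist_ge0 connG (qV i) (qV i.+1); rewrite /pos; lra.
have [es|ns] := eqVneq (last (q 0%N) p) s.
  by exists p; rewrite potentialS ls es; split=> //; lra.
have nsE : lab i <> lab i.+1 by rewrite lp ls => -[/eqP]; rewrite (negPf ns).
have fi := hr i _ i_n lp (fun e => nsE (etrans lp (esym e))).
have fi1 := hl i _ i_n ls (fun e => nsE (etrans e (esym ls))).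
have [_ oT od] := owner_claim (qV i); rewrite (fown _ _ fi) in oT od.
have [_ oT1 od1] := owner_claim (qV i.+1); rewrite (fown _ _ fi1) in oT1 od1.
exists (rcons p s); rewrite rcons_path pP last_rcons; split=> //=.
  apply/adj_quotient; exists (q i), (q i.+1).
  by rewrite (fown _ _ fi) (fown _ _ fi1); split=> //; exact: q_adj.
rewrite -cats1 walk_weight_cat walk_weight_cons walk_weight_nil addr0 /=.
rewrite pair_weightE ?tV // potentialS.
have -> : edge_potential M (pos G q) (tpos G T t0 q) lab i =
    2 * tdist G T t0 (q i) + 2 * tdist G T t0 (q i.+1).
  rewrite /edge_potential ls lp /=; case: eqP => // -[e].
  by rewrite e eqxx in ns.
have h1 := rdist_tri connG (tV oT) (qV i) (tV oT1).
have h2 := rdist_tri connG (qV i) (qV i.+1) (tV oT1).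
rewrite (rdist_sym connG (tV oT) (qV i)) in h1.
by rewrite /pos in wp dx *; lra.
Qed.

End Contraction.

(** * Distortion *)

Lemma exists_terminal_geodesics (R : realType) (U : finType) (G : wgraph R U)
    (T : {set U}) : graph_connected G -> T \subset verts G ->
  exists (n : U * U -> nat) (q : U * U -> nat -> U), forall p : U * U,
    [&& p.1 \in T, p.2 \in T & p.1 != p.2] ->
    [/\ terminal_geodesic G T (n p) (q p), q p 0%N = p.1 & q p (n p) = p.2].
Proof.
move=> connG TV.
have H (p : U * U) : exists nq : nat * (nat -> U),
    [&& p.1 \in T, p.2 \in T & p.1 != p.2] ->
    [/\ terminal_geodesic G T nq.1 nq.2, nq.2 0%N = p.1 & nq.2 nq.1 = p.2].
  have [/and3P[sT tT st]|_] := boolP [&& _, _ & _]; last by exists (0%N, fun=> p.1).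
  have sV := fintype.subsetP TV _ sT; have tV := fintype.subsetP TV _ tT.
  have [n [q [q0 qn q1 q2 q3]]] := geodesic connG sV tV.
  exists (n, q) => _; split=> //=; split; rewrite ?q0 ?qn //.
  by rewrite ltNge; apply: contra st => /(rdist_eq0 connG sV tV) ->.
have [F hF] := choice H.
by exists (fun p => (F p).1), (fun p => (F p).2).
Qed.

(** Since 3/4 <= e^(-1/4), the bound on [m] gives (3/4)^m <= 1/k, and (1 + 1/k)^k <= e. *)
Lemma expR_geometric_le (R : realType) (k m : nat) :
  (0 < k)%N -> 4 * ln k%:R <= m%:R :> R ->
  (1 + (3 / 4) ^+ m) ^+ k <= expR (1 : R).
Proof.
move=> k0 km; have kr : 0 < k%:R :> R by rewrite ltr0n.
have h : (3 / 4 : R) ^+ m <= k%:R^-1.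
  have -> : k%:R^-1 = expR (- ln k%:R) :> R by rewrite expRN lnK.
  apply: le_trans (_ : expR (- (1 / 4) : R) ^+ m <= _).
    apply: lerXn2r; rewrite ?nnegrE ?expR_ge0 //.
    by apply: le_trans (expR_ge1Dx _); lra.
  by rewrite -expRM_natr ler_expR; lra.
apply: le_trans (_ : expR (k%:R^-1 : R) ^+ k <= _).
  apply: lerXn2r; rewrite ?nnegrE ?expR_ge0 ?addr_ge0 ?exprn_ge0 //.
  by apply: le_trans (expR_ge1Dx _); rewrite lerD2l.
by rewrite -expRM_natl mulfV ?gt_eqF.
Qed.

Lemma approx_minor_ln (R : realType) (U : finType) (G : wgraph R U) (T : {set U}) :
  graph_connected G -> T \subset verts G -> (0 < #|T|)%N ->
  exists G', approx_minor G T (297 + 592 * ln #|T|%:R) G'.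
Proof.
move=> connG TV T0; set k := #|T|.
have [t0 t0T] : exists t0, t0 \in T by apply/card_gt0P.
have kr : 0 < k%:R :> R by rewrite ltr0n.
have lk : 0 <= ln k%:R :> R by rewrite ln_ge0 // ler1n.
pose m := (Num.truncn (4 * ln k%:R : R)).+1.
have [m1 m2] : 4 * ln (k%:R : R) <= m%:R /\ m%:R <= 4 * ln (k%:R : R) + 1.
  have l0 : 0 <= 4 * ln (k%:R : R) by rewrite mulr_ge0.
  have /andP[h1 h2] := truncn_itv l0.
  by rewrite /m; split; [rewrite ltW|rewrite -natr1 lerD2r].
have [n [q hq]] := exists_terminal_geodesics connG TV.
pose P (p : U * U) := [&& p.1 \in T, p.2 \in T & p.1 != p.2].
have hP p : P p -> terminal_geodesic G T (n p) (q p) by move=> /hq[].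
have [f [lab [fT flab]]] :=
  @exists_clustering _ _ _ _ t0 _ P n q m connG TV t0T isT hP.
have mr : 1 <= m%:R :> R by rewrite ler1n.
set lam := fun p => (96 * rdist G (q p 0%N) (q p (n p)))^-1.
set M := 100 * m%:R : R.
have M14 : 14 <= M by rewrite /M; lra.
have dpos p : P p -> 0 < rdist G (q p 0%N) (q p (n p)) by move=> /hP[].
move=> hsum; exists (contraction connG TV t0T fT).
have init p : P p -> expR (lam p * potential M (pos G (q p)) (tpos G T t0 (q p))
    (fun=> None : option U) (n p)) = expR (100 / 96 * m%:R).
  move=> Pp; congr expR; rewrite (potential_active _ _ _ (leq0n (n p))) //.
  rewrite {1}/potential big_ord0 add0r /pos.
  have [_ qV _ _ dp] := hP p Pp; rewrite (rdist_refl connG (qV _)) subr0 /lam /M.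
  by field; rewrite gt_eqF.
have total : \sum_(p | P p) expR (lam p * potential M (pos G (q p))
    (tpos G T t0 (q p)) (lab p) (n p)) <= expR (1 + 2 * ln k%:R + 100 / 96 * m%:R).
  apply: le_trans hsum _.
  rewrite (eq_bigr _ init) sumr_const !expRD -[leRHS]mulrA; apply: ler_pM.
  - by rewrite exprn_ge0 // addr_ge0 // exprn_ge0 //; lra.
  - by rewrite mulrn_wge0 // expR_ge0.
  - exact: expR_geometric_le.
  (* The term 2 ln k accounts for at most k^2 pairs. *)
  rewrite -[leLHS]mulr_natl ler_wpM2r ?expR_ge0 // expRM_natl lnK ?posrE // -natrX ler_nat.
  rewrite -mulnn -cardsX; apply: subset_leq_card; apply/fintype.subsetP => -[s t].
  by rewrite unfold_in => /and3P[/= sT tT _]; rewrite finset.in_setX sT tT.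
split=> [||s t sT tT]; [exact: contraction_verts fT|exact: contraction_minor|].
split; first exact: contraction_dist_ge.
have sV := fintype.subsetP TV _ sT; have tV := fintype.subsetP TV _ tT.
rewrite (distE connG) // -EFinM.
have [<-|st] := eqVneq s t.
  rewrite (rdist_refl connG) // mulr0.
  by have := @dist_le_walk _ _ (contraction connG TV t0T fT) s [::] isT; rewrite walk_weight_nil.
have Pp : P (s, t) by rewrite /P /= sT tT st.
have [qT q0 qn] := hq _ Pp; rewrite /= in q0 qn.
apply: le_trans (_ : (dist (contraction connG TV t0T fT) (q (s, t) 0%N) (q (s, t) (n (s, t))) <= _)%E).
  by rewrite q0 qn.
apply: le_trans (contraction_dist_le connG TV t0T fT M14 qT (flab _ Pp)) _.
rewrite lee_fin q0 qn.
have := dpos _ Pp; set L := rdist _ _ _; have -> : L = rdist G s t by rewrite /L q0 qn.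
set L' := rdist G s t => L0.
set F := potential _ _ _ _ _.
(* One term is at most the whole sum of positive terms. With m <= 4 ln k + 1 this gives [F] <= (196
   + 592 ln k) [L']. *)
have hF : (96 * L')^-1 * F <= 1 + 2 * ln k%:R + 100 / 96 * m%:R.
  rewrite -ler_expR; apply: le_trans total.
  rewrite (bigD1 (s, t)) //= -[leLHS]addr0 lerD //; last first.
    by apply: sumr_ge0 => p _; exact: expR_ge0.
  by rewrite /lam q0 qn.
rewrite ler_pdivrMl ?mulr_gt0 // in hF.
have : L' * (96 * (1 + 2 * ln k%:R) + 100 * m%:R) <=
    L' * (196 + 592 * ln k%:R) by rewrite ler_pM2l //; lra.
lra.
Qed.

Theorem theorem2p1 (R : realType) :
  (exists2 c : R, 0 < c &
    forall (U : finType) (G : wgraph R U) (T : {set U}),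
      graph_connected G -> T \subset verts G -> (2 <= #|T|)%N ->
      exists (G' : wgraph R U) (kappa : R),
        approx_minor G T kappa G' /\ kappa <= c * ln (#|T|%:R) ^+ 2) /\
  (exists k0 : nat,
    forall (U : finType) (G : wgraph R U) (T : {set U}),
      graph_connected G -> T \subset verts G -> (2 <= #|T|)%N ->
      (k0 <= #|T|)%N ->
      exists (G' : wgraph R U) (kappa : R),
        approx_minor G T kappa G' /\
        kappa <= (2 * 10 ^+ 8) * ln (#|T|%:R) ^+ 2).
Proof.
have H (U : finType) (G : wgraph R U) (T : {set U}) :
    graph_connected G -> T \subset verts G -> (2 <= #|T|)%N ->
    exists (G' : wgraph R U) (kappa : R),
      approx_minor G T kappa G' /\ kappa <= (2 * 10 ^+ 8) * ln (#|T|%:R) ^+ 2.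
  move=> connG TV T2; have [G' hG'] := approx_minor_ln connG TV (ltnW T2).
  exists G', (297 + 592 * ln #|T|%:R); split=> //.
  (* As e^(1/2) <= 2 <= k. A lower bound on ln k lets ln^2 k absorb the constant and the linear
     term. *)
  have l2 : 1 / 2 <= ln #|T|%:R :> R.
    rewrite -ler_expR lnK ?posrE ?ltr0n ?(ltnW T2) //.
    apply: le_trans (_ : 2 <= _); last by rewrite ler_nat.
    apply: le_trans (expR_le_inv _) _; first lra.
    by rewrite -div1r ler_pdivrMr; lra.
  set l := ln _ in l2 *.
  have e8 : 10000 <= 2 * 10 ^+ 8 :> R by rewrite !exprS expr0; lra.
  have l0 : 0 <= l ^+ 2 by exact: sqr_ge0.
  have : 10000 * l ^+ 2 <= 2 * 10 ^+ 8 * l ^+ 2 by rewrite ler_wpM2r.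
  have : 1 / 2 * l <= l * l by rewrite ler_pM2r //; lra.
  by rewrite -expr2; lra.
split; last by exists 0%N => U G T connG TV T2 _; exact: H.
by exists (2 * 10 ^+ 8) => //; rewrite mulr_gt0 ?exprn_gt0.
Qed.
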